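(* Let $X$ be a Banach space as described in the context, let $f\in X$ and $\rho\in(0,\infty)$. Then $f$ is (the restriction to $\mathbb{D}$ of) an entire function of finite order $\rho$ if and only if $$\limsup_{n\to\infty}\frac{n\ln n}{\ln\frac{\|z^n\|}{E_n(f)}}=\rho .$$
   Context: $\mathbb{D}=\{z\in\mathbb{C}:|z|<1\}$. $X$ is a complex Banach space of functions analytic in $\mathbb{D}$ whose norm $\|\cdot\|$ satisfies: (i) $\|f(\cdot\, e^{it})\|=\|f(\cdot)\|$ for all $t\in\mathbb{R}$ and $f\in X$; (ii) $\|f\|<\infty$ for every entire function $f$; (iii) for all $f\in X$ and $g\in L[0,2\pi]$, $\big\|\frac{1}{2\pi}\int_0^{2\pi} f(ze^{it})g(t)\,dt\big\|\le \frac{1}{2\pi}\int_0^{2\pi}|g(t)|\,dt\cdot\|f\|$. For $n\ge 1$, $\mathcal{P}_n$ is the set of complex polynomials of degree at most $n-1$, $E_n(f)=\inf_{p\in\mathcal{P}_n}\|f-p\|$, and $\|z^n\|$ is the norm in $X$ of the monomial $z\mapsto z^n$. The order of an entire function $F$ is $\limsup_{r\to\infty}\frac{\ln\ln M(r)}{\ln r}$, $M(r)=\max_{|z|=r}|F(z)|$. *)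

(* Defs.v *)
From HB Require Import structures.
From mathcomp Require Import all_boot all_order all_algebra.
From mathcomp Require Import all_classical all_reals all_analysis.
From mathcomp Require Import complex.
Set Implicit Arguments.
Unset Strict Implicit.
Unset Printing Implicit Defensive.
Import Order.TTheory GRing.Theory Num.Theory.
Import numFieldNormedType.Exports.
Local Open Scope classical_set_scope.
Local Open Scope ring_scope.
Local Open Scope complex_scope.

Section Defs.
Variable R : realType.
Local Notation C := R[i].

Definition cabs (z : C) : R := Normc.normc z.

Definition inD (z : C) : Prop := cabs z < 1.

Definition expi (t : R) : C := cos t +i* sin t.

Definition cdiff (F : C -> C) (z : C) : Prop :=
  exists l : C, forall eps : R, 0 < eps -> exists delta : R, 0 < delta /\
    forall h : C, h != 0 -> cabs h < delta ->
      cabs ((F (z + h) - F z) / h - l) < eps.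

Definition analytic_in_D (f : C -> C) : Prop := forall z, inD z -> cdiff f z.
Definition entire (F : C -> C) : Prop := forall z, cdiff F z.

Definition I02pi : set R := `[0, pi *+ 2]%classic.

Definition L1_02pi (g : R -> C) : Prop :=
  (@lebesgue_measure R).-integrable I02pi (fun t => (complex.Re (g t))%:E) /\
  (@lebesgue_measure R).-integrable I02pi (fun t => (complex.Im (g t))%:E).

Definition cint (h : R -> C) : C :=
  (Rintegral (@lebesgue_measure R) I02pi (fun t => complex.Re (h t)))
  +i* (Rintegral (@lebesgue_measure R) I02pi (fun t => complex.Im (h t))).

Definition L1norm_avg (g : R -> C) : R :=
  (pi *+ 2)^-1 * Rintegral (@lebesgue_measure R) I02pi (fun t => cabs (g t)).

Definition conv_op (f : C -> C) (g : R -> C) : C -> C :=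
  fun z => ((pi *+ 2)^-1)%:C * cint (fun t => f (z * expi t) * g t).

(* The complex Banach space X of functions analytic in D, with the properties
   (i), (ii), (iii). Elements are represented by functions C -> C; only their
   values on D matter (axiom [ext]). *)
Record BanachSpaceD := {
  inX : (C -> C) -> Prop;
  nrm : (C -> C) -> R;
  ext : forall f g, (forall z, inD z -> f z = g z) ->
          (inX f <-> inX g) /\ nrm f = nrm g;
  analytic : forall f, inX f -> analytic_in_D f;
  inX0 : inX (fun _ => 0);
  inXD : forall f g, inX f -> inX g -> inX (fun z => f z + g z);
  inXZ : forall (a : C) f, inX f -> inX (fun z => a * f z);
  nrm_ge0 : forall f, inX f -> 0 <= nrm f;
  nrm_eq0 : forall f, inX f -> (nrm f = 0 <-> forall z, inD z -> f z = 0);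
  nrmZ : forall (a : C) f, inX f -> nrm (fun z => a * f z) = cabs a * nrm f;
  nrm_triangle : forall f g, inX f -> inX g ->
          nrm (fun z => f z + g z) <= nrm f + nrm g;
  complete : forall u : nat -> C -> C, (forall n, inX (u n)) ->
    (forall eps : R, 0 < eps -> exists N, forall m n, (N <= m)%N -> (N <= n)%N ->
        nrm (fun z => u m z - u n z) < eps) ->
    exists f, inX f /\ forall eps : R, 0 < eps -> exists N, forall n, (N <= n)%N ->
        nrm (fun z => u n z - f z) < eps;
  rot_inX : forall f (t : R), inX f -> inX (fun z => f (z * expi t));
  rot_nrm : forall f (t : R), inX f -> nrm (fun z => f (z * expi t)) = nrm f;
  entire_inX : forall F, entire F -> inX F;
  conv_inX : forall f g, inX f -> L1_02pi g -> inX (conv_op f g);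
  conv_nrm : forall f g, inX f -> L1_02pi g ->
    nrm (conv_op f g) <= L1norm_avg g * nrm f
}.

Definition polyn (n : nat) (c : nat -> C) : C -> C :=
  fun z => \sum_(k < n) c k * z ^+ k.

Definition En (X : BanachSpaceD) (n : nat) (f : C -> C) : R :=
  inf [set nrm X (fun z => f z - polyn n c z) | c in [set: nat -> C]].

Definition nrm_mono (X : BanachSpaceD) (n : nat) : R := nrm X (fun z => z ^+ n).

(* the n-th term  n ln n / ln (||z^n|| / E_n(f)), as an extended real:
   equal to 0 when E_n(f) = 0 (the logarithm is +oo), +oo when the logarithm
   vanishes. *)
Definition ratio_term (X : BanachSpaceD) (f : C -> C) (n : nat) : \bar R :=
  if En X n f == 0 then 0%E
  else let L := ln (nrm_mono X n / En X n f) in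
       if L == 0 then +oo%E else ((n%:R * ln (n%:R : R)) / L)%:E.

Definition maxmod (F : C -> C) (r : R) : R :=
  sup [set cabs (F z) | z in [set z : C | cabs z = r]].

Definition order_of (F : C -> C) : \bar R :=
  limf_esup (fun r : R => (ln (ln (maxmod F r)) / ln r)%:E) (pinfty_nbhs R).

End Defs.

(* Main.v *)
Require Import Defs.
From HB Require Import structures.
From mathcomp Require Import all_boot all_order all_algebra.
From mathcomp Require Import all_classical all_reals all_analysis.
From mathcomp Require Import complex ring lra.
Set Implicit Arguments.
Unset Strict Implicit.
Unset Printing Implicit Defensive.
Import Order.TTheory GRing.Theory Num.Theory.
Import numFieldNormedType.Exports.
Local Open Scope classical_set_scope.
Local Open Scope ring_scope.
Local Open Scope complex_scope.

(* For f in X, convolving with e^{-int} gives an element of X, hence a complex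
   differentiable function on D, which picks up the factor e^{ins} under
   z |-> z e^{is}; therefore it equals c_n z^n. So the Fourier coefficients of f on
   circles come from a power series, and f is determined by (c_n) because the
   Fourier coefficients determine a continuous function; Cauchy's theorem is not
   needed. Property (iii) gives |c_n| ||z^n|| <= E_n(f), and completeness gives
   E_n(f) <= sum_{k >= n} |c_k| ||z^k||. A sliding hump argument shows that
   ln ||z^n|| = O(n), so up to factors e^{O(n)} the ratio E_n(f) / ||z^n|| decays
   like |c_n|, and for every s, up to an arbitrarily small change of s,
   E_n(f) <= ||z^n|| n^(-n/s) amounts to |F(z)| <= exp(|z|^s) for large |z|. *)

(** Membership in X gives information only inside D, whereas the order of F concerns large circles.
    The bridge is rescaling: z |-> F(az) is again entire, hence in X, and its n-th coefficient is
    a^n times that of F. The Cauchy estimates on large circles and the identity theorem for entire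
    functions both come from this.

    No estimate is sharp. All comparisons are between s and some s' > s, and the gap n ln n (1/s -
    1/s') outgrows every multiple of n. So the factors 2 from splitting into real and imaginary
    parts, the bounds 8^-n and D^n on the norms of monomials, and evaluation at radius 2r instead of
    r are all absorbed.

    The delicate point is the sign of the logarithm: where E_n(f) > ||z^n|| the ratio is negative,
    so an upper bound on the ratio says nothing about decay. If F is given, E_n(f) < ||z^n|| follows
    from a decay rate already proved. If only the limsup is given, rho > 0 provides positive ratios
    infinitely often, and one of them starts an induction. *)

Section ComplexModulus.
Variable R : realType.
Local Notation C := R[i].
Implicit Types (z w : C) (x y t s : R).

Lemma complex_eq z w :
  complex.Re z = complex.Re w -> complex.Im z = complex.Im w -> z = w.
Proof. by case: z w => [a b] [c d] /= -> ->. Qed.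

Lemma RecD z w : complex.Re (z + w) = complex.Re z + complex.Re w.
Proof. by case: z w => [a b] [c d]. Qed.

Lemma ImcD z w : complex.Im (z + w) = complex.Im z + complex.Im w.
Proof. by case: z w => [a b] [c d]. Qed.

Lemma RecN z : complex.Re (- z) = - complex.Re z.
Proof. by case: z. Qed.

Lemma ImcN z : complex.Im (- z) = - complex.Im z.
Proof. by case: z. Qed.

Lemma RecM z w : complex.Re (z * w) =
  complex.Re z * complex.Re w - complex.Im z * complex.Im w.
Proof. by case: z w => [a b] [c d]. Qed.

Lemma ImcM z w : complex.Im (z * w) =
  complex.Re z * complex.Im w + complex.Im z * complex.Re w.
Proof. by case: z w => [a b] [c d]. Qed.

Lemma sqr_cabs z : cabs z ^+ 2 = complex.Re z ^+ 2 + complex.Im z ^+ 2.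
Proof.
by case: z => a b; rewrite /cabs /= sqr_sqrtr // addr_ge0 // sqr_ge0.
Qed.

Lemma cabs_ge0 z : 0 <= cabs z.
Proof. by case: z => a b; exact: sqrtr_ge0. Qed.

Lemma cabs0 : cabs (0 : C) = 0. Proof. exact: Normc.normc0. Qed.
Lemma cabs1 : cabs (1 : C) = 1. Proof. exact: Normc.normc1. Qed.
Lemma cabsM z w : cabs (z * w) = cabs z * cabs w.
Proof. exact: Normc.normcM. Qed.
Lemma cabsV z : cabs z^-1 = (cabs z)^-1. Proof. exact: Normc.normcV. Qed.
Lemma cabsD z w : cabs (z + w) <= cabs z + cabs w.
Proof. exact: le_normcD. Qed.
Lemma cabsN z : cabs (- z) = cabs z. Proof. exact: normcN. Qed.
Lemma cabsB z w : cabs (z - w) <= cabs z + cabs w.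
Proof. by rewrite -(cabsN w) cabsD. Qed.
Lemma cabsC z w : cabs (z - w) = cabs (w - z).
Proof. by rewrite -cabsN opprB. Qed.
Lemma cabsX z n : cabs (z ^+ n) = cabs z ^+ n.
Proof. by elim: n => [|n IH]; rewrite ?expr0 ?cabs1 // !exprS cabsM IH. Qed.

Lemma cabs_eq0 z : (cabs z == 0) = (z == 0).
Proof. by apply/eqP/eqP => [/Normc.eq0_normc|->]; rewrite ?cabs0. Qed.

Lemma cabs_gt0 z : (0 < cabs z) = (z != 0).
Proof. by rewrite lt0r cabs_ge0 andbT cabs_eq0. Qed.

Lemma cabs_real x : cabs x%:C = `|x|.
Proof. by rewrite /cabs /= expr0n addr0 sqrtr_sqr. Qed.

Lemma abs_Re_le z : `|complex.Re z| <= cabs z.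
Proof.
rewrite -(ler_pXn2r (ltn0Sn 1)) ?nnegrE ?cabs_ge0 //.
by rewrite sqr_cabs real_normK ?num_real // lerDl sqr_ge0.
Qed.

Lemma abs_Im_le z : `|complex.Im z| <= cabs z.
Proof.
rewrite -(ler_pXn2r (ltn0Sn 1)) ?nnegrE ?cabs_ge0 //.
by rewrite sqr_cabs real_normK ?num_real // lerDr sqr_ge0.
Qed.

Lemma cabs_le_ReIm z : cabs z <= `|complex.Re z| + `|complex.Im z|.
Proof.
rewrite -(ler_pXn2r (ltn0Sn 1)) ?nnegrE ?cabs_ge0 ?addr_ge0 //.
rewrite sqr_cabs sqrrD !real_normK ?num_real //.
have := mulr_ge0 (normr_ge0 (complex.Re z)) (normr_ge0 (complex.Im z)).
by lra.
Qed.

Lemma cabs_sum (I : Type) (r : seq I) (P : pred I) (F : I -> C) :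
  cabs (\sum_(i <- r | P i) F i) <= \sum_(i <- r | P i) cabs (F i).
Proof.
elim/big_rec2: _ => [|i y x _ IH]; first by rewrite cabs0.
by apply: (le_trans (cabsD _ _)); rewrite lerD2l.
Qed.

Lemma cabs_eps0 z : (forall eps, 0 < eps -> cabs z <= eps) -> z = 0.
Proof.
move=> H; apply/eqP; rewrite -cabs_eq0 eq_le cabs_ge0 andbT.
by apply/ler_addgt0Pl => e e0; rewrite addr0 H.
Qed.

Lemma cabs_expi t : cabs (expi t) = 1.
Proof. by rewrite /cabs /= cos2Dsin2 sqrtr1. Qed.

Lemma expiD s t : expi (s + t) = expi s * expi t.
Proof. by apply: complex_eq; rewrite ?RecM ?ImcM /= ?cosD ?sinD //; ring. Qed.

Lemma expi0 : expi (0 : R) = 1.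
Proof. by rewrite /expi cos0 sin0. Qed.

Lemma expi_neq0 t : expi t != 0.
Proof. by rewrite -cabs_eq0 cabs_expi oner_neq0. Qed.

Lemma expiX t n : expi t ^+ n = expi (n%:R * t).
Proof.
by elim: n => [|n IH]; rewrite ?mul0r ?expi0 // exprS IH -expiD -natr1 mulrDl mul1r addrC.
Qed.

Lemma expi2pi t : expi (t + pi *+ 2) = expi t.
Proof. by rewrite /expi cosD2pi sinD2pi. Qed.

Lemma expipi : expi (pi : R) = -1.
Proof. by apply: complex_eq; rewrite /= ?cospi ?sinpi ?oppr0. Qed.

Lemma expi_2piM (k : int) : expi (k%:~R * (pi *+ 2)) = 1 :> C.
Proof.
have E (n : nat) : expi (n%:R * (pi *+ 2)) = 1 :> C.
  elim: n => [|n IH]; first by rewrite mul0r expi0.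
  by rewrite -natr1 mulrDl mul1r expi2pi.
case: k => n; first exact: E.
have := E n.+1; set x := _ * _ => Ex.
have : expi (- x) * expi x = 1 by rewrite -expiD addNr expi0.
by rewrite Ex mulr1 /x NegzE intrN mulNr.
Qed.

(** The angle is [acos] of the normalized real part, negated when the imaginary part is negative.
    Its compact range is what allows bounds on whole circles. *)
Lemma polar z : exists t, - pi <= t <= pi /\ z = (cabs z)%:C * expi t.
Proof.
have [->|z0] := eqVneq z 0.
  by exists 0; rewrite cabs0 mul0r oppr_le0 pi_ge0.
set r := cabs z; have r0 : 0 < r by rewrite cabs_gt0.
set x := complex.Re z / r; set y := complex.Im z / r.
have xy : x ^+ 2 + y ^+ 2 = 1.
  rewrite !exprMn -mulrDl -sqr_cabs -/r exprVn divff //.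
  by rewrite expf_neq0 // gt_eqF.
have x1 : -1 <= x <= 1.
  rewrite -ler_norml -(ler_pXn2r (ltn0Sn 1)) ?nnegrE // real_normK ?num_real //.
  by rewrite expr1n -xy lerDl sqr_ge0.
have cx : cos (acos x) = x by rewrite acosK // in_itv.
have sx : sin (acos x) = `|y|.
  by rewrite sin_acos // -xy addrC addKr sqrtr_sqr.
have a0 := acos_ge0 x1; have api := acos_lepi x1; have p0 := pi_ge0 R.
have E : z = r%:C * (x +i* y).
  apply: complex_eq; rewrite ?RecM ?ImcM /=.
  - by rewrite mul0r subr0 mulrC divfK ?gt_eqF.
  - by rewrite mul0r addr0 mulrC divfK ?gt_eqF.
have [y0|y0] := leP 0 y.
  exists (acos x); split; first by apply/andP; split; lra.
  by rewrite /expi cx sx ger0_norm.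
exists (- acos x); split; first by apply/andP; split; lra.
by rewrite /expi cosN sinN cx sx ltr0_norm // opprK.
Qed.

End ComplexModulus.

(** * Elementary calculus of complex derivatives *)

Section ComplexDerivative.
Variable R : realType.
Local Notation C := R[i].
Implicit Types (z w l : C) (F G : C -> C).

(** Division by [h] is avoided, so [h = 0] is no exception and the sum and product rules become
    plain estimates. *)
Definition cderiv F z l := forall eps : R, 0 < eps ->
  exists2 d : R, 0 < d & forall h, cabs h < d ->
    cabs (F (z + h) - F z - l * h) <= eps * cabs h.

Lemma cdiffP F z : cdiff F z <-> exists l, cderiv F z l.
Proof.
split=> -[l H]; exists l => eps e0.
  have [d [d0 Hd]] := H _ e0; exists d => // h hd.
  have [->|h0] := eqVneq h 0.
    by rewrite addr0 subrr mulr0 subrr cabs0 mulr0.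
  rewrite -ler_pdivrMr ?cabs_gt0 // -cabsV -cabsM mulrBl mulfK //.
  by rewrite ltW // Hd.
have [d d0 Hd] := H (eps / 2) (divr_gt0 e0 (ltr0Sn _ 1)).
exists d; split=> // h h0 hd.
have /Hd := hd; rewrite -ler_pdivrMr ?cabs_gt0 // -cabsV -cabsM mulrBl mulfK //.
by move=> /le_lt_trans; apply; lra.
Qed.

Lemma cderiv_cont F z l : cderiv F z l -> forall eps : R, 0 < eps ->
  exists2 d : R, 0 < d & forall h, cabs h < d -> cabs (F (z + h) - F z) < eps.
Proof.
move=> H e e0; have [d d0 Hd] := H 1 ltr01.
have k0 : 0 < 1 + cabs l by rewrite ltr_pwDl // cabs_ge0.
exists (Num.min d (e / (1 + cabs l))).
  by rewrite lt_min d0 divr_gt0.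
move=> h; rewrite lt_min => /andP[hd he].
have -> : F (z + h) - F z = (F (z + h) - F z - l * h) + l * h by ring.
apply: (le_lt_trans (cabsD _ _)); rewrite cabsM.
apply: (@le_lt_trans _ _ ((1 + cabs l) * cabs h)).
  by rewrite mulrDl lerD2r Hd.
by rewrite mulrC -ltr_pdivlMr.
Qed.

Lemma cdiff_cont F z : cdiff F z -> forall eps : R, 0 < eps ->
  exists2 d : R, 0 < d & forall w, cabs (w - z) < d -> cabs (F w - F z) < eps.
Proof.
move=> /cdiffP[l /cderiv_cont H] e /H[d d0 Hd]; exists d => // w /Hd.
by rewrite (addrC z) subrK.
Qed.

Lemma cderiv_cst (a : C) z : cderiv (fun=> a) z 0.
Proof.
by move=> e e0; exists 1 => // h _; rewrite subrr mul0r subrr cabs0 mulr_ge0 ?cabs_ge0 // ltW.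
Qed.

Lemma cderiv_id z : cderiv id z 1.
Proof.
move=> e e0; exists 1 => // h _; rewrite mul1r /=.
by rewrite (addrC z) addrK subrr cabs0 mulr_ge0 ?cabs_ge0 // ltW.
Qed.

Lemma cderivD F G z l m : cderiv F z l -> cderiv G z m ->
  cderiv (fun w => F w + G w) z (l + m).
Proof.
move=> HF HG e e0; have e2 : 0 < e / 2 by lra.
have [d d0 Hd] := HF _ e2; have [d' d'0 Hd'] := HG _ e2.
exists (Num.min d d'); first by rewrite lt_min d0.
move=> h; rewrite lt_min => /andP[/Hd H1 /Hd' H2].
have -> : F (z + h) + G (z + h) - (F z + G z) - (l + m) * h =
  (F (z + h) - F z - l * h) + (G (z + h) - G z - m * h) by ring.
apply: (le_trans (cabsD _ _)); lra.
Qed.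

Lemma cderivM F G z l m : cderiv F z l -> cderiv G z m ->
  cderiv (fun w => F w * G w) z (l * G z + F z * m).
Proof.
move=> HF HG e e0.
have [g g0 cG] := cderiv_cont HG ltr01.
have [K K0 HK] : exists2 K : R, 0 < K &
    [/\ cabs (G z) + 1 <= K, cabs l <= K & cabs (F z) <= K].
  exists (cabs (G z) + 1 + cabs l + cabs (F z)).
    by move: (cabs_ge0 (G z)) (cabs_ge0 l) (cabs_ge0 (F z)); lra.
  by move: (cabs_ge0 (G z)) (cabs_ge0 l) (cabs_ge0 (F z)); split; lra.
have eK : 0 < e / (3 * K) by rewrite divr_gt0 // mulr_gt0.
have [d d0 Hd] := HF _ eK; have [d' d'0 Hd'] := HG _ eK.
have [d'' d''0 Hd''] := cderiv_cont HG eK.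
case: HK => KG Kl KF.
exists (Num.min (Num.min d d') (Num.min g d'')).
  by rewrite !lt_min d0 d'0 g0 d''0.
move=> h; rewrite !lt_min => /andP[/andP[/Hd H1 /Hd' H2] /andP[/cG H3 /Hd'' H4]].
have -> : F (z + h) * G (z + h) - F z * G z - (l * G z + F z * m) * h =
  (F (z + h) - F z - l * h) * G (z + h) + F z * (G (z + h) - G z - m * h)
  + l * (G (z + h) - G z) * h by ring.
have GK : cabs (G (z + h)) <= K.
  have -> : G (z + h) = G z + (G (z + h) - G z) by ring.
  by apply: (le_trans (cabsD _ _)); lra.
have h0 := cabs_ge0 h.
have E : e * cabs h = e / (3 * K) * cabs h * K + K * (e / (3 * K) * cabs h) +
    K * (e / (3 * K)) * cabs h by field; rewrite gt_eqF.
rewrite E.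
apply: (le_trans (cabsD _ _)); apply: lerD.
  apply: (le_trans (cabsD _ _)); rewrite !cabsM; apply: lerD;
    by apply: ler_pM => //; exact: cabs_ge0.
rewrite !cabsM; apply: ler_pM => //; first by rewrite mulr_ge0 ?cabs_ge0.
by apply: ler_pM => //; [exact: cabs_ge0|exact: cabs_ge0|exact: ltW].
Qed.

Lemma cdiff_cst (a : C) z : cdiff (fun=> a) z.
Proof. by apply/cdiffP; exists 0; exact: cderiv_cst. Qed.

Lemma cdiffD F G z : cdiff F z -> cdiff G z -> cdiff (fun w => F w + G w) z.
Proof.
by move=> /cdiffP[l Hl] /cdiffP[m Hm]; apply/cdiffP; exists (l + m); exact: cderivD.
Qed.

Lemma cdiffM F G z : cdiff F z -> cdiff G z -> cdiff (fun w => F w * G w) z.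
Proof.
move=> /cdiffP[l Hl] /cdiffP[m Hm]; apply/cdiffP.
by exists (l * G z + F z * m); exact: cderivM.
Qed.

Lemma cdiffX n z : cdiff (fun w => w ^+ n) z.
Proof.
elim: n => [|n IH]; first exact: cdiff_cst.
have -> : (fun w : C => w ^+ n.+1) = (fun w => w * w ^+ n).
  by apply/funext => w; rewrite exprS.
by apply: cdiffM IH; apply/cdiffP; exists 1; exact: cderiv_id.
Qed.

Lemma cdiff_polyn n (c : nat -> C) z : cdiff (Defs.polyn n c) z.
Proof.
elim: n => [|n IH].
  rewrite (_ : Defs.polyn 0 c = fun=> 0); first exact: cdiff_cst.
  by apply/funext => w; rewrite /Defs.polyn big_ord0.
rewrite (_ : Defs.polyn n.+1 c = fun w => Defs.polyn n c w + c n * w ^+ n).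
  by apply: cdiffD => //; apply: cdiffM; [exact: cdiff_cst|exact: cdiffX].
by apply/funext => w; rewrite /Defs.polyn big_ord_recr.
Qed.

Lemma cdiffV z : z != 0 -> cdiff (fun w => w^-1) z.
Proof.
move=> z0; apply/cdiffP; exists (- (z ^+ 2)^-1) => e e0.
have az : 0 < cabs z by rewrite cabs_gt0.
(* The first bound keeps |z + h| >= |z|/2; the second then makes the remainder |h|^2 / (|z|^2 |z +
   h|) at most e |h|. *)
exists (Num.min (cabs z / 2) (e * cabs z ^+ 3 / 2)).
  by rewrite lt_min !divr_gt0 ?mulr_gt0 ?exprn_gt0.
move=> h; rewrite lt_min => /andP[h1 h2].
have zh : cabs z / 2 <= cabs (z + h).
  have : cabs z <= cabs (z + h) + cabs h.
    by have := cabsB (z + h) h; rewrite addrK.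
  by lra.
have zh0 : z + h != 0 by rewrite -cabs_gt0; lra.
have -> : (z + h)^-1 - z^-1 - - (z ^+ 2)^-1 * h = h * h / (z ^+ 2 * (z + h)).
  by field; rewrite z0 zh0.
rewrite !cabsM cabsV cabsM cabsX mulrAC ler_wpM2r ?cabs_ge0 //.
rewrite ler_pdivrMr; last by rewrite mulr_gt0 ?exprn_gt0 //; lra.
apply: (le_trans (ltW h2)).
rewrite (_ : e * cabs z ^+ 3 / 2 = e * (cabs z ^+ 2 * (cabs z / 2))); last by field.
by apply: ler_wpM2l; [exact: ltW|apply: ler_wpM2l => //; exact: exprn_ge0 (ltW az)].
Qed.

Lemma cdiff_scale F (a : C) z : cdiff F (a * z) -> cdiff (fun w => F (a * w)) z.
Proof.
move=> /cdiffP[l H]; apply/cdiffP; exists (l * a) => e e0.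
have k0 : 0 < 1 + cabs a by rewrite ltr_pwDl // cabs_ge0.
have [d d0 Hd] := H (e / (1 + cabs a)) (divr_gt0 e0 k0).
exists (d / (1 + cabs a)); first exact: divr_gt0.
move=> h; rewrite ltr_pdivlMr // => hd.
rewrite mulrDr -mulrA; apply: (le_trans (Hd _ _)).
  apply: le_lt_trans hd; rewrite cabsM mulrC ler_wpM2l ?cabs_ge0 //.
  by rewrite lerDr.
rewrite cabsM mulrA ler_wpM2r ?cabs_ge0 // mulrAC ler_pdivrMr //.
by rewrite ler_wpM2l ?lerDr // ltW.
Qed.

(** Quotients by powers of z are usable only off the origin; continuity carries the identities
    obtained there across 0. *)
Lemma eq0_of_punctured F : cdiff F 0 ->
  (forall z, z != 0 -> inD z -> F z = 0) -> F 0 = 0.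
Proof.
move=> /cdiff_cont c H; apply: cabs_eps0 => e /c[d d0 Hd].
pose r := Num.min (d / 2) (1 / 2).
have r0 : 0 < r by rewrite lt_min; apply/andP; split; lra.
have r1 : r <= d / 2 by rewrite /r ge_min lexx.
have r2 : r <= 1 / 2 by rewrite /r ge_min lexx orbT.
have ar : cabs r%:C = r by rewrite cabs_real ger0_norm // ltW.
have := Hd r%:C; rewrite subr0 ar => /(_ ltac:(lra)).
rewrite H ?sub0r ?cabsN; first exact: ltW.
- by rewrite -cabs_gt0 ar.
- by rewrite /inD ar; lra.
Qed.

End ComplexDerivative.

(** * Real integrals over one period: translation invariance and a peak kernel *)

Section RealIntegral.
Variable R : realType.
Local Notation mu := (@lebesgue_measure R).
Local Notation J g := (Rintegral mu (@I02pi R) g).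
Implicit Types (g psi : R -> R) (x y s t l eps d : R).

Lemma twopi_gt0 : 0 < (pi : R) *+ 2.
Proof. by rewrite pmulrn_lgt0 // pi_gt0. Qed.

Lemma measurable_I02pi : measurable (@I02pi R).
Proof. exact: measurable_itv. Qed.

Lemma integrable_cont g : continuous g -> mu.-integrable (@I02pi R) (EFin \o g).
Proof.
move=> cg; apply: continuous_compact_integrable; first exact: segment_compact.
exact: continuous_subspaceT.
Qed.

Lemma is_derive_eps g x l :
  (forall eps, 0 < eps -> exists2 d, 0 < d & forall h, `|h| < d ->
     `|g (x + h) - g x - l * h| <= eps * `|h|) -> is_derive x 1 g l.
Proof.
move=> H.
have C : (fun h => h^-1 *: ((g \o shift x) (h *: 1) - g x)) @ 0^' --> l.
  apply/cvgrPdist_le => e e0; have [d d0 Hd] := H _ e0.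
  exists d => //= h /=; rewrite sub0r normrN => hd h0.
  rewrite /GRing.scale /= mulr1 (addrC h) distrC.
  have -> : h^-1 * (g (x + h) - g x) - l = h^-1 * (g (x + h) - g x - l * h).
    by field.
  by rewrite normrM normfV mulrC ler_pdivrMr ?normr_gt0 // Hd.
apply: DeriveDef; first by apply/cvg_ex; exists l.
exact: cvg_lim C.
Qed.

Lemma derive0_cst g (a b x y : R) :
  (forall t, a < t < b -> is_derive t 1 g 0) ->
  a < x < b -> a < y < b -> g x = g y.
Proof.
wlog xy : x y / x <= y.
  move=> W H hx hy; case: (leP x y) => [xy|/ltW yx]; first exact: W.
  by apply/esym; apply: W.
move=> H /andP[ax _] /andP[_ yb].
have D t : t \in `[x, y] -> is_derive t 1 g 0.
  rewrite in_itv /= => /andP[xt ty]; apply: H.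
  by rewrite (lt_le_trans ax xt) (le_lt_trans ty yb).
have D' t : t \in `]x, y[ -> is_derive t 1 g (cst 0 t).
  by move=> txy; apply: D; apply: subset_itv_oo_cc txy.
have C : {within `[x, y], continuous g}.
  by apply: derivable_within_continuous => t /D [].
have [c _] := MVT_segment xy D' C.
by rewrite mul0r => /subr0_eq.
Qed.

(** For a primitive [H] of [g], the integral of the translate by u is H(2 pi + u) - H(u), whose
    derivative g(2 pi + u) - g(u) vanishes by periodicity. *)
Lemma Rintegral_shift g s : continuous g -> (forall t, g (t + pi *+ 2) = g t) ->
  J (fun t => g (t + s)) = J g.
Proof.
move=> cg per.
(* The base point lies strictly to the left of [s] and 0, so [H] has a two-sided derivative wherever
   it is needed. *)
pose a := Num.min s 0 - 1.
have as_ : a < s by have : Num.min s 0 <= s by [rewrite ge_min lexx]; rewrite /a; lra.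
have a0 : a < 0 by have : Num.min s 0 <= 0 by [rewrite ge_min lexx orbT]; rewrite /a; lra.
pose H x := Rintegral mu `[a, x] g.
have dH x : a < x -> is_derive x 1 H (g x).
  move=> ax; have ig : mu.-integrable `[a, x + 1] (EFin \o g).
    apply: continuous_compact_integrable; first exact: segment_compact.
    exact: continuous_subspaceT.
  have x1 : x < x + 1 by rewrite ltrDl.
  have [d e] := continuous_FTC1_closed x1 ig ax (cg x).
  by apply: DeriveDef; [exact: d|rewrite -derive1E; exact: e].
clearbody H.
have dHs u t : a < t + u -> is_derive t 1 (fun x => H (x + u)) (g (t + u)).
  move=> ax; rewrite -[g _]mulr1.
  by apply: (@is_derive1_comp _ H (shift u)); [exact: dH|exact: is_derive_shift].
have p0 := twopi_gt0.
have FTC u : a < u -> J (fun t => g (t + u)) = H (pi *+ 2 + u) - H u.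
  move=> au; have D t : 0 <= t -> is_derive t 1 (fun x => H (x + u)) (g (t + u)).
    by move=> t0; apply: dHs; lra.
  have cH t : 0 <= t -> {for t, continuous (fun x => H (x + u))}.
    by move=> /D d; apply/differentiable_continuous/derivable1_diffP; exact: ex_derive.
  rewrite /Rintegral (@continuous_FTC2 R (fun t => g (t + u)) (fun x => H (x + u))) //.
  - by rewrite /= add0r.
  - apply: continuous_subspaceT => t; apply: continuous_comp; last exact: cg.
    by apply: cvgD; [exact: cvg_id|exact: cvg_cst].
  - split.
    + move=> t; rewrite in_itv /= => /andP[/ltW t0 _]; have := D _ t0.
      by move=> ?; exact: ex_derive.
    + by apply: cvg_at_right_filter; apply: cH.
    + by apply: cvg_at_left_filter; apply: cH; exact: ltW.
  - move=> t; rewrite in_itv /= => /andP[/ltW t0 _]; rewrite derive1E.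
    by apply: derive_val; exact: D.
have -> : J g = H (pi *+ 2) - H 0.
  have := FTC 0 a0; rewrite addr0 => <-.
  by apply: eq_Rintegral => t _; rewrite addr0.
rewrite FTC //.
pose G u := H (pi *+ 2 + u) - H u.
rewrite -/(G s) -[pi *+ 2 in RHS]addr0 -/(G 0).
apply: (@derive0_cst G a (`|s| + 1)).
- move=> t /andP[at_ _]; rewrite /G -(subrr (g t)).
  rewrite -{1}per; apply: is_deriveB; last exact: dH.
  under eq_fun do rewrite addrC.
  by apply: dHs; lra.
- by rewrite as_ /=; have := ler_norm s; lra.
- by rewrite a0 /=; have := normr_ge0 s; lra.
Qed.

Lemma continuous_bounded g (a b : R) : continuous g ->
  exists2 M, 0 < M & forall t, a <= t <= b -> `|g t| <= M.
Proof.
move=> cg; have [ab|ba] := leP a b; last first.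
  by exists 1 => // t /andP[at_ tb]; move: (le_trans at_ tb); rewrite leNgt ba.
have [c _ H] := @EVT_max R (fun t => `|g t|) a b ab
  (continuous_subspaceT (fun t => continuous_comp (cg t) (@norm_continuous _ _ _))).
exists (`|g c| + 1); first by rewrite ltr_wpDl.
by move=> t tab; apply: (le_trans (H t _)); rewrite ?in_itv // lerDl.
Qed.

Lemma Rintegral_cst_itv (a b c : R) : a < b ->
  Rintegral mu `[a, b] (fun=> c) = c * (b - a).
Proof.
move=> ab; rewrite Rintegral_cst; last exact: measurable_itv.
have H : mu `[a, b]%classic = (b - a)%:E.
  by rewrite lebesgue_measure_itv /= lte_fin ab -EFinB.
by rewrite -[X in _ = _ * X]/(fine (b - a)%:E) -H.
Qed.

Lemma Rintegral_cst02pi (b : R) : J (fun=> b) = b * (pi *+ 2).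
Proof. by rewrite /I02pi Rintegral_cst_itv ?twopi_gt0 // subr0. Qed.

Lemma expr_small (x e : R) : 0 <= x < 1 -> 0 < e ->
  exists N, forall n, (N <= n)%N -> x ^+ n < e.
Proof.
move=> /andP[x0 x1] e0.
have /cvgrPdist_lt /(_ _ e0) [N _ HN] : (fun n => x ^+ n) @ \oo --> (0 : R).
  by apply: cvg_expr; rewrite ger0_norm.
exists N => n /HN /=; rewrite sub0r normrN ger0_norm //; exact: exprn_ge0.
Qed.

Lemma ler_cos (x y : R) : 0 <= x -> x <= y -> y <= pi -> cos y <= cos x.
Proof.
move=> x0; rewrite le_eqVlt => /predU1P[->//|xy] ypi; apply: ltW.
rewrite ltr_cos // in_itv /=; apply/andP; split; lra.
Qed.

(* The kernels ((1 - cos t) / 2)^N concentrate at t = pi. *)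
Lemma Rintegral_peak_gt0 psi : continuous psi -> 0 < psi pi ->
  exists N, 0 < J (fun t => psi t * ((1 - cos t) / 2) ^+ N).
Proof.
move=> cpsi p0; set m := psi pi / 2; have m0 : 0 < m by rewrite /m; lra.
have [M M0 HM] := @continuous_bounded psi 0 (pi *+ 2) cpsi.
have pi0 := pi_gt0 R.
have [d d0 [dpi Hd]] : exists2 d, 0 < d & d < pi /\ forall t, `|t - pi| < d -> m <= psi t.
  have /cvgrPdist_lt /(_ _ m0) [d /= d0 Hd] := cpsi pi.
  exists (Num.min d (pi / 2)); first by rewrite lt_min d0 divr_gt0.
  split; first by rewrite gt_min; apply/orP; right; lra.
  move=> t; rewrite lt_min => /andP[td _]; have := Hd t.
  rewrite /= distrC => /(_ td); rewrite ltr_norml => /andP[_]; rewrite /m; lra.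
(* [q e] is the value of the kernel at distance [e] from pi. *)
pose K t : R := (1 - cos t) / 2; pose q e : R := (1 + cos e) / 2.
have K0 t : 0 <= K t by have := cos_le1 t; rewrite /K; lra.
have K_q t : K t = q `|t - pi|.
  by rewrite /K /q cos_norm -{1}(subrK pi t) cosDpi opprK.
have I02 t : @I02pi R t -> 0 <= t <= pi *+ 2 /\ `|t - pi| <= pi.
  rewrite /I02pi /= in_itv /= mulr2n => /andP[t0 t1]; split.
    by rewrite t0.
  by rewrite ler_norml; apply/andP; split; lra.
have q01 : q d < q (d / 2).
  have : cos d < cos (d / 2).
    by rewrite ltr_cos ?in_itv /=; [lra|apply/andP; split; lra|apply/andP; split; lra].
  by rewrite /q; lra.
have q00 : 0 <= q d by have := cos_geN1 d; rewrite /q; lra.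
have q10 : 0 < q (d / 2) by lra.
(* With this [N] the window of width [d] around pi, worth at least m q(d/2)^N d, outweighs the worst
   negative part M q(d)^N over the whole period. *)
have [N /(_ N (leqnn _)) HN] : exists N, forall n, (N <= n)%N ->
    (q d / q (d / 2)) ^+ n < m * d / (M * (pi *+ 2)).
  apply: expr_small; last by rewrite divr_gt0 ?mulr_gt0 // twopi_gt0.
  by rewrite divr_ge0 ?(ltW q10) //= ltr_pdivrMr // mul1r.
exists N.
have cK : continuous (fun t => psi t * K t ^+ N).
  move=> t; apply: cvgM; first exact: cpsi.
  apply: (@continuous_comp _ _ _ K (fun y => y ^+ N)); last exact: exprn_continuous.
  apply: cvgM; last exact: cvg_cst.
  by apply: cvgB; [exact: cvg_cst|exact: continuous_cos].
have ccst (a : R) : continuous (fun _ : R => a) by move=> t; exact: cvg_cst.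
pose A := `[pi - d / 2, pi + d / 2]%classic : set R.
have AI : A `<=` @I02pi R.
  move=> t; rewrite /A /I02pi /= !in_itv /= (mulr2n pi) => /andP[t0 t1].
  by apply/andP; split; lra.
pose c := m * q (d / 2) ^+ N.
have c0 : 0 < c by rewrite mulr_gt0 // exprn_gt0.
have JA : J (cst c \_ A) = c * d.
  rewrite -Rintegral_mkcondr (setIidr AI) Rintegral_cst_itv; last lra.
  by congr (_ * _); lra.
have JM := Rintegral_cst02pi (M * q d ^+ N).
(* Once M q(d)^N is added, the integrand is at least [c] on the window and nonnegative elsewhere:
   within distance [d] of pi since [psi] is positive there, farther away since the kernel is at most
   [q d]. *)
have : J (cst c \_ A) <= J (fun t => psi t * K t ^+ N + M * q d ^+ N).
  apply: le_Rintegral; first exact: measurable_I02pi.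
  - rewrite -restrict_EFin; apply/integrable_restrict.
    + exact: measurable_itv.
    + exact: measurable_I02pi.
    + rewrite (setIidr AI); apply: continuous_compact_integrable.
        exact: segment_compact.
      by apply: continuous_subspaceT; exact: ccst.
  - apply: integrable_cont => t.
    by apply: cvgD; [exact: cK|exact: ccst].
  - move=> t /I02 [tI tpi].
    have K1 : K t <= 1 by have := cos_geN1 t; rewrite /K; lra.
    have H0 : 0 <= M * q d ^+ N by rewrite mulr_ge0 ?exprn_ge0 // ltW.
    rewrite /patch; case: ifPn => [|_].
      rewrite inE /A /= in_itv /= => /andP[t0 t1].
      have td : `|t - pi| <= d / 2 by rewrite ler_norml; apply/andP; split; lra.
      rewrite -[X in X <= _]addr0 lerD // /c; apply: ler_pM; rewrite ?exprn_ge0 ?(ltW m0) ?(ltW q10) //.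
        by apply: Hd; lra.
      apply: lerXn2r; rewrite ?nnegrE ?K0 ?(ltW q10) // K_q.
      have := ler_cos (normr_ge0 (t - pi)) td; rewrite /q; lra.
    change (0 <= psi t * K t ^+ N + M * q d ^+ N).
    have [td|td] := ltP `|t - pi| d.
      apply: addr_ge0 => //; apply: mulr_ge0; last exact: exprn_ge0.
      exact: le_trans (ltW m0) (Hd _ td).
    have KN : K t ^+ N <= q d ^+ N.
      apply: lerXn2r; rewrite ?nnegrE //.
      have := ler_cos (ltW d0) td tpi; rewrite K_q /q; lra.
    have HMt : - M <= psi t by have := HM t tI; rewrite ler_norml => /andP[].
    have K0N : 0 <= K t ^+ N by exact: exprn_ge0.
    have : - M * K t ^+ N <= psi t * K t ^+ N by rewrite ler_wpM2r.
    have : M * K t ^+ N <= M * q d ^+ N by rewrite ler_wpM2l // ltW.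
    lra.
rewrite RintegralD ?JA ?JM; last 3 first.
- exact: measurable_I02pi.
- exact: integrable_cont.
- by apply: integrable_cont => t; exact: ccst.
move: HN; rewrite expr_div_n ltr_pdivrMr ?exprn_gt0 // mulrAC.
rewrite ltr_pdivlMr; last by rewrite mulr_gt0 // twopi_gt0.
rewrite /c -/(K _).
have -> : q d ^+ N * (M * (pi *+ 2)) = M * q d ^+ N * (pi *+ 2) by ring.
have -> : m * d * q (d / 2) ^+ N = m * q (d / 2) ^+ N * d by ring.
by move=> H1 H2; lra.
Qed.

End RealIntegral.

(** * Complex integrals; Fourier coefficients determine a continuous function *)

Section ComplexIntegral.
Variable R : realType.
Local Notation C := R[i].
Local Notation mu := (@lebesgue_measure R).
Local Notation J g := (Rintegral mu (@I02pi R) g).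
Implicit Types (h : R -> C) (a z : C) (s t : R).

Definition ccont h :=
  continuous (fun t => complex.Re (h t)) /\ continuous (fun t => complex.Im (h t)).

Lemma ccont_eps h : (forall t (e : R), 0 < e -> exists2 d : R, 0 < d &
    forall s, `|s - t| < d -> cabs (h s - h t) < e) -> ccont h.
Proof.
move=> H; split=> t; apply/cvgrPdist_lt => e e0; have [d d0 Hd] := H t e e0;
  exists d => //= s; rewrite /= distrC => /Hd; apply: le_lt_trans; rewrite distrC.
- by rewrite -RecN -RecD abs_Re_le.
- by rewrite -ImcN -ImcD abs_Im_le.
Qed.

Lemma ccont_modulus h : ccont h -> forall t (e : R), 0 < e ->
  exists2 d : R, 0 < d & forall s, `|s - t| < d -> cabs (h s - h t) < e.
Proof.
move=> [hr hi] t e e0; have e2 : 0 < e / 2 by lra.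
have /cvgrPdist_lt /(_ _ e2) [d1 /= d10 H1] := hr t.
have /cvgrPdist_lt /(_ _ e2) [d2 /= d20 H2] := hi t.
exists (Num.min d1 d2); first by rewrite lt_min d10.
move=> s; rewrite lt_min ![`|s - t|]distrC => /andP[/H1 /= B1 /H2 /= B2].
apply: (le_lt_trans (cabs_le_ReIm _)); rewrite RecD ImcD RecN ImcN.
by move: B1 B2; rewrite ![`|_ (h t) - _ (h s)|]distrC; lra.
Qed.

Lemma ccont_cst a : ccont (fun=> a).
Proof. by split=> t; exact: cvg_cst. Qed.

Lemma ccontD h1 h2 : ccont h1 -> ccont h2 -> ccont (fun t => h1 t + h2 t).
Proof.
move=> [r1 i1] [r2 i2]; split=> t.
  by under eq_fun do rewrite RecD; apply: cvgD; [exact: r1|exact: r2].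
by under eq_fun do rewrite ImcD; apply: cvgD; [exact: i1|exact: i2].
Qed.

Lemma ccontM h1 h2 : ccont h1 -> ccont h2 -> ccont (fun t => h1 t * h2 t).
Proof.
move=> [r1 i1] [r2 i2]; split=> t.
  under eq_fun do rewrite RecM.
  by apply: cvgB; apply: cvgM; (exact: r1||exact: r2||exact: i1||exact: i2).
under eq_fun do rewrite ImcM.
by apply: cvgD; apply: cvgM; (exact: r1||exact: r2||exact: i1||exact: i2).
Qed.

Lemma ccont_expi (a : R) : ccont (fun t => expi (a * t)).
Proof.
have ca : continuous (fun t : R => a * t).
  by move=> t; apply: cvgM; [exact: cvg_cst|exact: cvg_id].
split=> t /=; apply: continuous_comp; try exact: ca.
  exact: continuous_cos.
exact: continuous_sin.
Qed.

Lemma ccont_circle (f : C -> C) z : (forall t, cdiff f (z * expi t)) ->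
  ccont (fun t => f (z * expi t)).
Proof.
move=> df; apply: ccont_eps => t e e0.
have [d d0 Hd] := cdiff_cont (df t) e0.
have k0 : 0 < 1 + cabs z by rewrite ltr_pwDl // cabs_ge0.
have [d' d'0 Hd'] := ccont_modulus (ccont_expi 1) t (divr_gt0 d0 k0).
exists d' => // s /Hd'; rewrite !mul1r ltr_pdivlMr // => H.
apply: Hd; rewrite -mulrBr cabsM; apply: le_lt_trans H.
by rewrite mulrC ler_wpM2l ?cabs_ge0 // lerDr.
Qed.

Lemma cint_eq h1 h2 : (forall t, h1 t = h2 t) -> cint h1 = cint h2.
Proof. by move=> /funext ->. Qed.

Lemma cintD h1 h2 : ccont h1 -> ccont h2 ->
  cint (fun t => h1 t + h2 t) = cint h1 + cint h2.
Proof.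
move=> [r1 i1] [r2 i2]; apply: complex_eq; rewrite ?RecD ?ImcD /=.
- under eq_Rintegral do rewrite RecD.
  by rewrite RintegralD //; [exact: measurable_I02pi|exact: integrable_cont|exact: integrable_cont].
- under eq_Rintegral do rewrite ImcD.
  by rewrite RintegralD //; [exact: measurable_I02pi|exact: integrable_cont|exact: integrable_cont].
Qed.

Lemma cintZ a h : ccont h -> cint (fun t => a * h t) = a * cint h.
Proof.
move=> [r i]; have Z (b : R) (g : R -> R) : continuous g -> continuous (fun t => b * g t).
  by move=> cg t; apply: cvgM; [exact: cvg_cst|exact: cg].
have mI := @measurable_I02pi R.
apply: complex_eq; rewrite ?RecM ?ImcM /=.
- under eq_Rintegral do rewrite RecM.
  by rewrite RintegralB ?RintegralZl //; apply: integrable_cont => //; exact: Z.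
- under eq_Rintegral do rewrite ImcM.
  by rewrite RintegralD ?RintegralZl //; apply: integrable_cont => //; exact: Z.
Qed.

Lemma cint_cst a : cint (fun=> a) = (pi *+ 2)%:C * a.
Proof.
by apply: complex_eq; rewrite ?RecM ?ImcM /= Rintegral_cst02pi; ring.
Qed.

Lemma cint_bound h (B : R) : ccont h -> (forall t, cabs (h t) <= B) ->
  cabs (cint h) <= 2 * B * (pi *+ 2).
Proof.
move=> [r i] HB; apply: (le_trans (cabs_le_ReIm _)) => /=.
have P (g : R -> R) : continuous g -> (forall t, `|g t| <= B) ->
    `|J g| <= B * (pi *+ 2).
  move=> cg gB; rewrite -Rintegral_cst02pi.
  apply: (le_trans (le_normr_Rintegral _ _)) => //.
  - exact: measurable_I02pi.
  - exact: integrable_cont.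
  - apply: le_Rintegral => //; first exact: measurable_I02pi.
    + by apply: integrable_cont => t; apply: continuous_comp; [exact: cg|exact: norm_continuous].
    + by apply: integrable_cont => t; exact: cvg_cst.
rewrite -mulrA mulr_natl mulr2n; apply: lerD; apply: P => // t.
  exact: le_trans (abs_Re_le _) (HB t).
exact: le_trans (abs_Im_le _) (HB t).
Qed.

Lemma cint_shift h s : ccont h -> (forall t, h (t + pi *+ 2) = h t) ->
  cint (fun t => h (t + s)) = cint h.
Proof.
move=> [r i] per; apply: complex_eq => /=.
  by apply: (Rintegral_shift s r) => t; rewrite per.
by apply: (Rintegral_shift s i) => t; rewrite per.
Qed.

(** [K] is a trigonometric polynomial, so all Fourier coefficients of h K^N vanish too. If h(pi)
    were nonzero, the real part of conj(h(pi)) h would be positive at pi, and so would its integral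
    against a high power of [K]. *)
Lemma fourier_uniqueness h : ccont h ->
  (forall k : int, cint (fun t => h t * expi (k%:~R * t)) = 0) -> h pi = 0.
Proof.
move=> ch H0; apply/eqP; apply: contraT => hpi.
pose K t : R := (1 - cos t) / 2.
pose e (k : int) t := expi (k%:~R * t) : C.
have KE : forall t, (K t)%:C = 2^-1 + (- 4^-1) * (e 1 t + e (-1) t).
  move=> t; have -> : e 1 t + e (-1) t = (2 * cos t)%:C.
    by apply: complex_eq; rewrite ?RecD ?ImcD /= mul1r mulN1r ?cosN ?sinN; ring.
  by rewrite /K rmorphM fmorphV rmorphB rmorph1 rmorphM !rmorph_nat; field.
have eD : forall k l u, e k u * e l u = e (k + l) u.
  by move=> k l u; rewrite /e -expiD -mulrDl intrD.
have ce k : ccont (e k) by exact: ccont_expi.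
have cK N : ccont (fun t => h t * (K t)%:C ^+ N).
  elim: N => [|N IH].
    by under eq_fun do rewrite expr0 mulr1.
  have -> : (fun t => h t * (K t)%:C ^+ N.+1) = (fun t => (h t * (K t)%:C ^+ N) *
      (2^-1 + - 4^-1 * (e 1 t + e (-1) t))).
    by apply/funext => u; rewrite exprSr mulrA {2}KE.
  apply: ccontM => //; apply: ccontD; first exact: ccont_cst.
  by apply: ccontM; [exact: ccont_cst|apply: ccontD; exact: ce].
(* The induction treats all frequencies at once, because multiplication by [K] mixes [k] with its
   two neighbours. *)
have HK : forall N k, cint (fun t => (h t * (K t)%:C ^+ N) * e k t) = 0.
  elim=> [|N IH] k.
    by rewrite -[RHS](H0 k); apply: cint_eq => u; rewrite expr0 mulr1.
  have cKe l : ccont (fun t => (h t * (K t)%:C ^+ N) * e l t) by exact: ccontM.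
  have -> : cint (fun t => h t * (K t)%:C ^+ N.+1 * e k t) =
     cint (fun t => 2^-1 * ((h t * (K t)%:C ^+ N) * e k t) +
        (- 4^-1) * ((h t * (K t)%:C ^+ N) * e (1 + k) t +
          (h t * (K t)%:C ^+ N) * e (-1 + k) t)).
    apply: cint_eq => u; rewrite exprSr {2}KE -!eD; ring.
  rewrite cintD ?cintZ ?cintD ?IH ?addr0 ?mulr0 ?addr0 //.
  - exact: ccontD.
  - exact: ccontM (ccont_cst _) (cKe _).
  - by apply: ccontM; [exact: ccont_cst|exact: ccontD].
pose a := conjc (h pi); pose psi t := complex.Re (a * h t).
have ca : ccont (fun t => a * h t) by exact: ccontM (ccont_cst _) ch.
have psi0 : 0 < psi pi.
  rewrite /psi RecM /a; case: (h pi) hpi => x y hpi /=.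
  rewrite mulNr opprK -!expr2 lt0r addr_ge0 ?sqr_ge0 // andbT.
  apply: contra hpi; rewrite paddr_eq0 ?sqr_ge0 // !sqrf_eq0.
  by move=> /andP[/eqP -> /eqP ->].
have [N] := Rintegral_peak_gt0 ca.1 psi0.
have := congr1 (@complex.Re R) (congr1 ( *%R a) (HK N 0)).
rewrite mulr0 -cintZ; last exact: ccontM.
rewrite /= => E; suff -> : J (fun t => psi t * ((1 - cos t) / 2) ^+ N) = 0 by rewrite ltxx.
rewrite -[RHS]E; apply: eq_Rintegral => t _.
rewrite /e mul0r expi0 mulr1 mulrA -rmorphXn /= RecM /= mulr0 subr0.
by [].
Qed.

End ComplexIntegral.

(** * Power series with infinite radius of convergence *)

Section PowerSeries.
Variable R : realType.
Local Notation C := R[i].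
Implicit Types (c u v : nat -> C) (z l : C).

Definition climit u l := forall e : R, 0 < e ->
  exists N, forall n, (N <= n)%N -> cabs (u n - l) <= e.

Lemma climit_le u l (K : R) : climit u l -> (forall n, cabs (u n) <= K) ->
  cabs l <= K.
Proof.
move=> H uK; apply/ler_addgt0Pl => e /H[N /(_ N (leqnn _)) HN].
have -> : l = u N - (u N - l) by ring.
by apply: (le_trans (cabsB _ _)); rewrite addrC lerD.
Qed.

Lemma climitD u v l m : climit u l -> climit v m ->
  climit (fun n => u n + v n) (l + m).
Proof.
move=> Hu Hv e e0; have e2 : 0 < e / 2 by lra.
have [N HN] := Hu _ e2; have [M HM] := Hv _ e2.
exists (maxn N M) => n; rewrite geq_max => /andP[/HN H1 /HM H2].
have -> : u n + v n - (l + m) = (u n - l) + (v n - m) by ring.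
by apply: (le_trans (cabsD _ _)); lra.
Qed.

Lemma climitZ (a : C) u l : climit u l -> climit (fun n => a * u n) (a * l).
Proof.
move=> H e e0; have k0 : 0 < 1 + cabs a by rewrite ltr_pwDl // cabs_ge0.
have [N HN] := H _ (divr_gt0 e0 k0); exists N => n /HN.
rewrite ler_pdivlMr // -mulrBr cabsM => H1; apply: le_trans H1.
by rewrite mulrC ler_wpM2l ?cabs_ge0 // lerDr.
Qed.

Lemma climitS u l : climit u l -> climit (fun n => u n.+1) l.
Proof. by move=> H e /H[N HN]; exists N => n Nn; apply: HN; exact: leqW. Qed.

Lemma climit_unique u l m : climit u l -> climit u m -> l = m.
Proof.
move=> Hl Hm; apply/eqP; rewrite -subr_eq0; apply/eqP.
apply: cabs_eps0 => e e0.
apply: (@climit_le (fun n => u n + (-1) * u n)); last first.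
  by move=> n; rewrite mulN1r subrr cabs0 ltW.
by rewrite -[- m]mulN1r; apply: climitD => //; exact: climitZ.
Qed.

(** The intervals of radius 2B/2^n about u_n are nested, as each increment is at most the decrease
    B/2^n of the radius; the limit is the supremum of their left ends. *)
Lemma real_geo_limit (u : nat -> R) (B : R) N : 0 <= B ->
  (forall n, (N <= n)%N -> `|u n.+1 - u n| <= B / 2 ^+ n) ->
  exists x, forall n, (N <= n)%N -> `|u n - x| <= 2 * B / 2 ^+ n.
Proof.
move=> B0 H; pose a n := u n - 2 * B / 2 ^+ n; pose b n := u n + 2 * B / 2 ^+ n.
have E n : 2 * B / 2 ^+ n.+1 = B / 2 ^+ n.
  by rewrite exprS; field; rewrite expf_neq0.
have E' n : 2 * B / 2 ^+ n = B / 2 ^+ n + B / 2 ^+ n by ring.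
have p n : 0 <= B / 2 ^+ n by rewrite divr_ge0 // exprn_ge0.
have aS n : (N <= n)%N -> a n <= a n.+1.
  by move=> /H; rewrite /a E E' ler_norml => /andP[]; lra.
have bS n : (N <= n)%N -> b n.+1 <= b n.
  by move=> /H; rewrite /b E E' ler_norml => /andP[]; lra.
have am n k : (N <= n)%N -> a n <= a (n + k)%N.
  move=> Nn; elim: k => [|k IH]; first by rewrite addn0.
  by rewrite addnS (le_trans IH) // aS // (leq_trans Nn) // leq_addr.
have bm n k : (N <= n)%N -> b (n + k)%N <= b n.
  move=> Nn; elim: k => [|k IH]; first by rewrite addn0.
  by rewrite addnS (le_trans _ IH) // bS // (leq_trans Nn) // leq_addr.
have ab m n : (N <= m)%N -> (N <= n)%N -> a m <= b n.
  move=> Nm Nn; apply: (le_trans (am _ n Nm)); rewrite addnC.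
  apply: le_trans (bm _ m Nn); rewrite /a /b E'.
  by have := p (n + m)%N; lra.
pose S := [set x | exists2 n, (N <= n)%N & x = a n].
have S0 : S !=set0 by exists (a N); exists N.
have Sb n : (N <= n)%N -> ubound S (b n).
  by move=> Nn _ [m Nm ->]; exact: ab.
exists (sup S) => n Nn.
have H1 : a n <= sup S.
  by apply: ub_le_sup; [exists (b N); exact: Sb|exists n].
have H2 : sup S <= b n by apply: ge_sup => //; exact: Sb.
by move: H1 H2; rewrite /a /b ler_norml => H1 H2; apply/andP; split; lra.
Qed.

Lemma geo_limit u (B : R) N : 0 <= B ->
  (forall n, (N <= n)%N -> cabs (u n.+1 - u n) <= B / 2 ^+ n) ->
  exists2 l, climit u l & forall n, (N <= n)%N -> cabs (u n - l) <= 4 * B / 2 ^+ n.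
Proof.
move=> B0 H.
have [x Hx] : exists x, forall n, (N <= n)%N ->
    `|complex.Re (u n) - x| <= 2 * B / 2 ^+ n.
  apply: real_geo_limit => // n /H; apply: le_trans.
  by rewrite -RecN -RecD abs_Re_le.
have [y Hy] : exists y, forall n, (N <= n)%N ->
    `|complex.Im (u n) - y| <= 2 * B / 2 ^+ n.
  apply: real_geo_limit => // n /H; apply: le_trans.
  by rewrite -ImcN -ImcD abs_Im_le.
have K n : (N <= n)%N -> cabs (u n - (x +i* y)) <= 4 * B / 2 ^+ n.
  move=> Nn; apply: (le_trans (cabs_le_ReIm _)).
  rewrite RecD ImcD RecN ImcN /=.
  have := Hx n Nn; have := Hy n Nn; lra.
exists (x +i* y) => // e e0.
have [M HM] : exists N, forall n, (N <= n)%N -> (2^-1 : R) ^+ n < e / (4 * B + 1).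
  apply: expr_small; last by rewrite divr_gt0 //; lra.
  by rewrite invr_ge0 ler0n /= invf_lt1 // ltr1n.
exists (maxn N M) => n; rewrite geq_max => /andP[/K Hn /HM].
rewrite ltr_pdivlMr; last by lra.
rewrite exprVn => H2; apply: (le_trans Hn); apply: ltW; apply: le_lt_trans H2.
by rewrite mulrC ler_wpM2l ?invr_ge0 ?exprn_ge0 // lerDl.
Qed.

Lemma geo_sum (a : nat -> R) (B : R) m n : 0 <= B ->
  (forall k, (m <= k)%N -> a k <= B / 2 ^+ k) ->
  \sum_(m <= k < n) a k <= 2 * B / 2 ^+ m.
Proof.
move=> B0 H; have [mn|nm] := leqP m n; last first.
  by rewrite big_geq ?(ltnW nm) // !mulr_ge0 ?invr_ge0 ?exprn_ge0.
suff : \sum_(m <= k < n) a k <= 2 * B / 2 ^+ m - 2 * B / 2 ^+ n.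
  have : 0 <= 2 * B / 2 ^+ n by rewrite !mulr_ge0 ?invr_ge0 ?exprn_ge0.
  lra.
elim: n mn => [|n IH]; first by rewrite leqn0 => /eqP ->; rewrite big_geq // subrr.
rewrite leq_eqVlt => /predU1P[->|]; first by rewrite big_geq // subrr.
rewrite ltnS => mn; rewrite big_nat_recr //=.
have := IH mn; have := H n mn.
have -> : 2 * B / 2 ^+ n.+1 = B / 2 ^+ n.
  by rewrite exprS; field; rewrite expf_neq0.
lra.
Qed.

(** Equivalent to |c_n|^(1/n) -> 0, the Cauchy-Hadamard condition for an infinite radius of
    convergence. *)
Definition superexp c := forall r : R, 0 < r ->
  exists N, forall n, (N <= n)%N -> cabs (c n) * r ^+ n <= 1.

Lemma superexp_bound c (r : R) : superexp c -> 0 < r ->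
  exists2 B, 0 < B & forall n, cabs (c n) * r ^+ n <= B.
Proof.
move=> H r0; have [N HN] := H r r0.
have p k : 0 <= cabs (c k) * r ^+ k by rewrite mulr_ge0 ?cabs_ge0 ?exprn_ge0 // ltW.
have s0 : 0 <= \sum_(k < N) cabs (c k) * r ^+ k by apply: sumr_ge0.
exists (1 + \sum_(k < N) cabs (c k) * r ^+ k); first lra.
move=> n; have [/HN|nN] := leqP N n; first by lra.
rewrite (bigD1 (Ordinal nN)) //=.
have : 0 <= \sum_(i < N | i != Ordinal nN) cabs (c i) * r ^+ i by apply: sumr_ge0.
lra.
Qed.

(** The value is 0 by default where the partial sums diverge. *)
Definition pser c z : C := xget 0 [set l | climit (fun n => Defs.polyn n c z) l].

Lemma pser_climit c z l : climit (fun n => Defs.polyn n c z) l -> pser c z = l.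
Proof.
move=> H; apply: (climit_unique _ H).
by rewrite /pser; case: xgetP => [x _|/(_ l)] //.
Qed.

Lemma polyn_recr n c z : Defs.polyn n.+1 c z = Defs.polyn n c z + c n * z ^+ n.
Proof. by rewrite /Defs.polyn big_ord_recr. Qed.

(** A bound on the terms at radius 2r leaves terms of size at most B/2^n on |z| <= r. *)
Lemma pser_approx c (r B : R) z : 0 <= r -> 0 <= B ->
  (forall n, cabs (c n) * (2 * r) ^+ n <= B) -> cabs z <= r ->
  climit (fun n => Defs.polyn n c z) (pser c z) /\
  forall n, cabs (Defs.polyn n c z - pser c z) <= 4 * B / 2 ^+ n.
Proof.
move=> r0 B0 H zr.
have [||l Hl K] := @geo_limit (fun n => Defs.polyn n c z) B 0 => //.
  move=> n _; rewrite polyn_recr addrC addKr cabsM cabsX.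
  rewrite ler_pdivlMr ?exprn_gt0 // -mulrA.
  apply: le_trans (H n); rewrite ler_wpM2l ?cabs_ge0 // exprMn mulrC.
  rewrite ler_wpM2l ?exprn_ge0 //; apply: lerXn2r; rewrite ?nnegrE ?cabs_ge0 //.
by rewrite (pser_climit Hl); split=> // n; exact: K.
Qed.

Lemma pser_bound c (r B : R) z : 0 <= r -> 0 <= B ->
  (forall n, cabs (c n) * (2 * r) ^+ n <= B) -> cabs z <= r ->
  cabs (pser c z) <= 4 * B.
Proof.
move=> r0 B0 H zr; have [_ /(_ 0%N)] := pser_approx r0 B0 H zr.
by rewrite /Defs.polyn big_ord0 sub0r cabsN expr0 divr1.
Qed.

Lemma superexp_climit c z : superexp c ->
  climit (fun n => Defs.polyn n c z) (pser c z).
Proof.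
move=> H; have r0 : 0 < 2 * (cabs z + 1) by have := cabs_ge0 z; lra.
have [B B0 HB] := superexp_bound H r0.
have r1 : 0 <= cabs z + 1 by have := cabs_ge0 z; lra.
have zr : cabs z <= cabs z + 1 by lra.
by have [] := pser_approx r1 (ltW B0) HB zr.
Qed.

Lemma superexp_deriv c : superexp c -> superexp (fun k => k.+1%:R * c k.+1).
Proof.
move=> H r r0; have r1 : 0 < 2 * (r + 1) by lra.
have [N HN] := H _ r1; exists N => n Nn.
apply: le_trans (HN n.+1 (leqW Nn)); rewrite cabsM.
have -> : cabs (n.+1%:R : C) = n.+1%:R.
  by rewrite -(rmorph_nat (real_complex R)) cabs_real normr_nat.
rewrite (mulrC n.+1%:R) -mulrA ler_wpM2l ?cabs_ge0 // exprMn.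
apply: ler_pM; rewrite ?ler0n ?exprn_ge0 ?(ltW r0) //.
  by rewrite -natrX ler_nat ltnW // ltn_expl.
rewrite exprS; have rn : r ^+ n <= (r + 1) ^+ n.
  by apply: lerXn2r; rewrite ?nnegrE; lra.
have : 0 <= r ^+ n by rewrite exprn_ge0 // ltW.
by nra.
Qed.

(** The second-order remainder gets a constant that is geometric in k, hence summable against
    [superexp] coefficients; its factor 2^(k+1) pays for the k + 1 arising in the induction. *)
Lemma expr_taylor1 (z h : C) k : cabs h <= 1 ->
  cabs ((z + h) ^+ k.+1 - z ^+ k.+1 - k.+1%:R * z ^+ k * h) <=
  cabs h ^+ 2 * (2 * (cabs z + 1)) ^+ k.+1.
Proof.
move=> h1; set r := cabs z + 1; have r1 : 1 <= r by have := cabs_ge0 z; rewrite /r; lra.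
have r0 : 0 <= r by lra.
elim: k => [|k IH].
  have -> : (z + h) ^+ 1 - z ^+ 1 - 1 * z ^+ 0 * h = 0 by ring.
  by rewrite cabs0 mulr_ge0 ?exprn_ge0 ?cabs_ge0 // mulr_ge0.
have -> : (z + h) ^+ k.+2 - z ^+ k.+2 - k.+2%:R * z ^+ k.+1 * h =
  (z + h) * ((z + h) ^+ k.+1 - z ^+ k.+1 - k.+1%:R * z ^+ k * h) +
  k.+1%:R * z ^+ k * h ^+ 2.
  by rewrite -(natr1 k.+1) !(exprS _ k.+1) !(exprS z k); ring.
apply: (le_trans (cabsD _ _)); rewrite !cabsM !cabsX.
have -> : cabs (k.+1%:R : C) = k.+1%:R.
  by rewrite -(rmorph_nat (real_complex R)) cabs_real normr_nat.
rewrite (exprS _ k.+1).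
have -> : cabs h ^+ 2 * (2 * r * (2 * r) ^+ k.+1) =
  r * (cabs h ^+ 2 * (2 * r) ^+ k.+1) + r * (2 * r) ^+ k.+1 * cabs h ^+ 2 by ring.
apply: lerD.
  apply: ler_pM => //; rewrite ?cabs_ge0 //.
  by apply: (le_trans (cabsD _ _)); rewrite lerD2l.
apply: ler_wpM2r; first by rewrite mulr_ge0 ?cabs_ge0.
rewrite exprMn.
apply: (@le_trans _ _ (2 ^+ k.+1 * r ^+ k.+1)); last first.
  by rewrite ler_peMl // mulr_ge0 ?exprn_ge0.
apply: ler_pM; rewrite ?ler0n ?exprn_ge0 ?cabs_ge0 //.
  by rewrite -natrX ler_nat ltnW // ltn_expl.
apply: (@le_trans _ _ (r ^+ k)).
  by apply: lerXn2r; rewrite ?nnegrE ?cabs_ge0 // /r lerDl.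
by rewrite exprS ler_peMl // exprn_ge0.
Qed.

(** For partial sums the first-order Taylor remainder is at most 2B|h|^2 whatever the number of
    terms, and this bound survives the limit. *)
Lemma pser_entire c : superexp c -> entire (pser c).
Proof.
move=> Hc z; set d := fun k => k.+1%:R * c k.+1.
have Hd : superexp d by exact: superexp_deriv.
set r := cabs z + 1; have r1 : 1 <= r by have := cabs_ge0 z; rewrite /r; lra.
(* Twice the base 2r of [expr_taylor1]: the spare factor 2 makes the sum of the remainders
   geometric. *)
have r4 : 0 < 4 * r by lra.
have [B B0 HB] := superexp_bound Hc r4.
have E h n : Defs.polyn n.+1 c (z + h) + (-1) * Defs.polyn n.+1 c z +
     (- h) * Defs.polyn n d z = \sum_(0 <= k < n)
     c k.+1 * ((z + h) ^+ k.+1 - z ^+ k.+1 - k.+1%:R * z ^+ k * h).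
  elim: n => [|n IH].
    by rewrite big_geq // !polyn_recr /Defs.polyn !big_ord0 !expr0; ring.
  have dE : d n = n.+1%:R * c n.+1 by [].
  by rewrite big_nat_recr //= -IH !(polyn_recr n.+1) (polyn_recr n d) dE; ring.
have key h n : cabs h <= 1 ->
  cabs (Defs.polyn n.+1 c (z + h) + (-1) * Defs.polyn n.+1 c z +
     (- h) * Defs.polyn n d z) <= cabs h ^+ 2 * (2 * B).
  move=> h1; rewrite E; apply: (le_trans (cabs_sum _ _ _)).
  apply: (@le_trans _ _ (\sum_(0 <= k < n) cabs h ^+ 2 * (cabs (c k.+1) * (2 * r) ^+ k.+1))).
    apply: ler_sum => k _; rewrite cabsM mulrCA ler_wpM2l ?cabs_ge0 //.
    exact: expr_taylor1.
  rewrite -mulr_sumr ler_wpM2l ?exprn_ge0 ?cabs_ge0 //.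
  have := @geo_sum (fun k => cabs (c k.+1) * (2 * r) ^+ k.+1) B 0 n (ltW B0).
  rewrite expr0 divr1; apply=> k _; rewrite ler_pdivlMr ?exprn_gt0 //.
  apply: le_trans (HB k.+1); rewrite -mulrA ler_wpM2l ?cabs_ge0 //.
  have -> : 4 * r = 2 * r * 2 by ring.
  rewrite [leRHS]exprMn ler_wpM2l ?exprn_ge0 //; first by lra.
  by rewrite exprS ler_peMl ?exprn_ge0 // ler1n.
have lim h : cabs h <= 1 ->
  cabs (pser c (z + h) + (-1) * pser c z + (- h) * pser d z) <= cabs h ^+ 2 * (2 * B).
  move=> h1; apply: climit_le (fun n => key h n h1).
  apply: climitD; last exact: climitZ (superexp_climit z Hd).
  apply: climitD; first exact: climitS (superexp_climit (z + h) Hc).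
  exact: climitZ (climitS (superexp_climit z Hc)).
apply/cdiffP; exists (pser d z) => e e0.
exists (Num.min 1 (e / (2 * B))); first by rewrite lt_min ltr01 divr_gt0 // mulr_gt0.
move=> h; rewrite lt_min => /andP[h1]; rewrite ltr_pdivlMr ?mulr_gt0 // => h2.
have := lim h (ltW h1); rewrite mulN1r mulNr (mulrC h) => H.
apply: (le_trans H).
have -> : cabs h ^+ 2 * (2 * B) = cabs h * (2 * B) * cabs h by ring.
by rewrite ler_wpM2r ?cabs_ge0 // ltW.
Qed.

End PowerSeries.

(** * Rotation-invariant differentiable functions are constant *)

Section RotationInvariance.
Variable R : realType.
Local Notation C := R[i].
Implicit Types (z w l : C) (b : C -> C) (s t : R).

(** The increments r(e^{is} - 1) tend to 0 and leave [b] unchanged, so the difference quotients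
    along them vanish. *)
Lemma cderiv_rot_inv b (r : R) l : 0 < r -> cderiv b r%:C l ->
  (forall s, b (r%:C * expi s) = b r%:C) -> l = 0.
Proof.
move=> r0 Hl inv; apply: cabs_eps0 => e e0.
have [d d0 Hd] := Hl e e0.
have [g g0 Hg] := ccont_modulus (ccont_expi 1) 0 (divr_gt0 d0 r0).
pose s := Num.min (g / 2) 1.
have s0 : 0 < s by rewrite lt_min ltr01 divr_gt0.
have s1 : s <= 1 by rewrite /s ge_min lexx orbT.
have sg : `|s - 0| < g.
  rewrite subr0 gtr0_norm //; have : s <= g / 2 by rewrite /s ge_min lexx.
  lra.
have := Hg s sg; rewrite !mul1r expi0 => es.
pose h := r%:C * (expi s - 1).
have hd : cabs h < d.
  by rewrite cabsM cabs_real gtr0_norm // mulrC -ltr_pdivlMr.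
have h0 : 0 < cabs h.
  rewrite cabs_gt0 mulf_neq0 //.
    by rewrite -cabs_gt0 cabs_real normr_gt0 gt_eqF.
  apply/eqP => /(congr1 (@complex.Im R)); rewrite ImcD ImcN /= subr0.
  have : 0 < sin s by apply: sin_gt0_pi; have := pi_ge2 R; rewrite s0 /=; lra.
  by move=> /lt0r_neq0 /eqP.
have := Hd h hd.
have -> : r%:C + h = r%:C * expi s by rewrite /h; ring.
by rewrite inv subrr sub0r cabsN cabsM ler_pM2r.
Qed.

(** The derivative vanishes at each point of the real segment (0, 1), so [b] is constant there;
    rotations carry this value to the rest of the punctured disc. *)
Lemma rot_inv_cst b :
  (forall z, z != 0 -> inD z -> cdiff b z) ->
  (forall z s, z != 0 -> inD z -> b (z * expi s) = b z) ->
  exists c, forall z, z != 0 -> inD z -> b z = c.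
Proof.
move=> db inv; exists (b (2^-1)%:C).
have nD (r : R) : 0 < r < 1 -> r%:C != 0 /\ inD r%:C.
  move=> /andP[r0 r1]; rewrite /inD -cabs_gt0 cabs_real gtr0_norm //.
have dr (r : R) : 0 < r < 1 -> forall e : R, 0 < e ->
    exists2 d, 0 < d & forall h : R, `|h| < d ->
      cabs (b (r + h)%:C - b r%:C) <= e * `|h|.
  move=> r01; have [rz rD] := nD r r01.
  have /cdiffP[l Hl] := db _ rz rD.
  have l0 : l = 0.
    case/andP: r01 => r0 r1.
    by apply: (cderiv_rot_inv r0 Hl) => s; exact: inv.
  move=> e /Hl[d d0 Hd]; exists d => // h hd.
  have := Hd h%:C; rewrite cabs_real l0 mul0r subr0 -rmorphD; exact.
have rc (r r' : R) : 0 < r < 1 -> 0 < r' < 1 -> b r%:C = b r'%:C.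
  move=> hr hr'; apply: complex_eq.
    apply: (@derive0_cst R (fun x => complex.Re (b x%:C)) 0 1) => // t /dr H.
    apply: is_derive_eps => e /H[d d0 Hd]; exists d => // h /Hd.
    by rewrite mul0r subr0 -RecN -RecD; exact: le_trans (abs_Re_le _).
  apply: (@derive0_cst R (fun x => complex.Im (b x%:C)) 0 1) => // t /dr H.
  apply: is_derive_eps => e /H[d d0 Hd]; exists d => // h /Hd.
  by rewrite mul0r subr0 -ImcN -ImcD; exact: le_trans (abs_Im_le _).
move=> z z0 zD; have [t [_ zE]] := polar z.
have z01 : 0 < cabs z < 1 by rewrite cabs_gt0 z0.
have [rz rD] := nD _ z01.
rewrite zE inv //; apply: rc => //.
by rewrite invr_gt0 ltr0n /= invf_lt1 // ltr1n.
Qed.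

End RotationInvariance.

(** * Fourier coefficients on circles and Taylor coefficients *)

Section Coefficients.
Variable R : realType.
Local Notation C := R[i].
Implicit Types (z w l : C) (f g : C -> C) (s t : R) (k : int) (n : nat).

Definition echar k (t : R) : C := expi (k%:~R * t).

(** The kernel is e^{+ikt}, so it is the frequency -n that picks out z^n. *)
Definition fourier f k : C -> C := conv_op f (echar k).

Lemma ccont_echar k : ccont (echar k).
Proof. exact: ccont_expi. Qed.

Lemma cabs_echar k t : cabs (echar k t) = 1.
Proof. exact: cabs_expi. Qed.

Lemma inD_rot z t : inD z -> inD (z * expi t).
Proof. by rewrite /inD cabsM cabs_expi mulr1. Qed.

Lemma ccont_integrand f k z : analytic_in_D f -> inD z ->
  ccont (fun t => f (z * expi t) * echar k t).
Proof.
move=> df zD; apply: ccontM; last exact: ccont_echar.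
by apply: ccont_circle => t; apply: df; exact: inD_rot.
Qed.

Lemma echarD2pi k t : echar k (t + pi *+ 2) = echar k t.
Proof. by rewrite /echar mulrDr expiD expi_2piM mulr1. Qed.

Lemma fourier_rot f k z s : analytic_in_D f -> inD z ->
  fourier f k (z * expi s) = expi (- (k%:~R * s)) * fourier f k z.
Proof.
move=> df zD; rewrite /fourier /conv_op mulrCA; congr (_ * _).
have ci := ccont_integrand k df zD.
rewrite -(@cint_shift R _ s ci); last first.
  by move=> t; rewrite echarD2pi expi2pi.
rewrite -cintZ; last first.
  have -> : (fun t => f (z * expi (t + s)) * echar k (t + s)) =
    (fun t => expi (k%:~R * s) * (f (z * expi s * expi t) * echar k t)).
    apply/funext => t; rewrite /echar mulrDr !expiD (mulrC (expi t) (expi s)) (mulrA z); ring.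
  apply: ccontM; first exact: ccont_cst.
  by apply: ccont_integrand => //; exact: inD_rot.
apply: cint_eq => t; rewrite /echar mulrDr !expiD (mulrC (expi t) (expi s)) (mulrA z).
have : expi (- (k%:~R * s)) * expi (k%:~R * s) = 1 :> C by rewrite -expiD addNr expi0.
set a := expi (- _); set b := expi (_ * s) => ab.
transitivity (a * b * (f (z * expi s * expi t) * expi (k%:~R * t))); last by ring.
by rewrite ab mul1r.
Qed.

Lemma L1_ccont h : ccont h -> @L1_02pi R h.
Proof. by move=> [r i]; split; exact: integrable_cont. Qed.

Lemma L1norm_echar k : L1norm_avg (echar k) = 1.
Proof.
rewrite /L1norm_avg; under eq_Rintegral do rewrite cabs_echar.
by rewrite Rintegral_cst02pi mul1r mulVf // gt_eqF // twopi_gt0.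
Qed.

(** For k nonzero, a shift by pi/k preserves the integral but multiplies the character by -1. *)
Lemma cint_echar k : cint (echar k) = if k == 0 then (pi *+ 2)%:C else 0.
Proof.
case: eqVneq => [->|k0].
  have -> : echar 0 = fun=> 1 by apply/funext => t; rewrite /echar mul0r expi0.
  by rewrite cint_cst mulr1.
have H := @cint_shift R _ (pi / k%:~R) (ccont_echar k) (echarD2pi k).
have E : cint (echar k) = - cint (echar k).
  rewrite -{1}H -mulN1r -cintZ; last exact: ccont_echar.
  apply: cint_eq => t; rewrite /echar mulrDr expiD mulrC; congr (_ * _).
  by rewrite mulrC divfK ?expipi // intr_eq0.
have : cint (echar k) *+ 2 = 0 by rewrite mulr2n {1}E addNr.
by move=> /eqP; rewrite mulrn_eq0 => /eqP.
Qed.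

Lemma conv_op_bound f k z (B : R) : analytic_in_D f -> inD z ->
  (forall w, cabs w = cabs z -> cabs (f w) <= B) ->
  cabs (fourier f k z) <= 2 * B.
Proof.
move=> df zD HB; rewrite /fourier /conv_op cabsM cabs_real.
have p := twopi_gt0 R; rewrite ger0_norm ?invr_ge0 ?(ltW p) //.
rewrite mulrC ler_pdivrMr //; apply: cint_bound; first exact: ccont_integrand.
by move=> t; rewrite cabsM cabs_echar mulr1 HB // cabsM cabs_expi mulr1.
Qed.

Lemma fourierB f g k z : analytic_in_D f -> analytic_in_D g -> inD z ->
  fourier (fun w => f w - g w) k z = fourier f k z - fourier g k z.
Proof.
move=> df dg zD; rewrite /fourier /conv_op -mulrBr; congr (_ * _).
have cf := ccont_integrand k df zD; have cg := ccont_integrand k dg zD.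
rewrite -[- cint _]mulN1r -cintZ // -cintD //; last exact: ccontM (ccont_cst _) cg.
by apply: cint_eq => t; ring.
Qed.

(** The Taylor coefficient, read off at the single point 1/2, where c_n z^n equals c_n / 2^n;
    [fourier_negz] shows that for elements of X the choice of point is immaterial. *)
Definition tcoef f n : C := fourier f (- n%:Z) (2^-1)%:C * 2 ^+ n.

Lemma half_inD : inD (2^-1 : R)%:C.
Proof. by rewrite /inD cabs_real ger0_norm ?invr_ge0 // invf_lt1 // ltr1n. Qed.

Lemma half_expn n : (2^-1)%:C ^+ n * 2 ^+ n = 1 :> C.
Proof.
by rewrite -exprMn rmorphV ?unitfE //= rmorph_nat mulVf ?expr1n.
Qed.

Lemma tcoef_intro f n c : fourier f (- n%:Z) (2^-1)%:C = c * (2^-1)%:C ^+ n ->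
  tcoef f n = c.
Proof. by rewrite /tcoef => ->; rewrite -mulrA half_expn mulr1. Qed.

Lemma tcoefB f g n : analytic_in_D f -> analytic_in_D g ->
  tcoef (fun w => f w - g w) n = tcoef f n - tcoef g n.
Proof. by move=> df dg; rewrite /tcoef fourierB // ?mulrBl //; exact: half_inD. Qed.

Lemma entire_analytic f : entire f -> analytic_in_D f.
Proof. by move=> H z _; exact: H. Qed.

Lemma polyn_entire n (c : nat -> C) : entire (Defs.polyn n c).
Proof. by move=> z; exact: cdiff_polyn. Qed.

Lemma tcoef_polyn m (c : nat -> C) n :
  tcoef (Defs.polyn m c) n = if (n < m)%N then c n else 0.
Proof.
apply: tcoef_intro; rewrite /fourier /conv_op.
set x := (2^-1)%:C; set p := (pi *+ 2) : R.
have p0 : p != 0 by rewrite gt_eqF // twopi_gt0.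
have -> : cint (fun t => Defs.polyn m c (x * expi t) * echar (- n%:Z) t) =
    \sum_(j < m) c j * x ^+ j * (if j == n :> nat then p%:C else 0).
  elim: m => [|m IH].
    rewrite big_ord0 (_ : (fun _ => _) = fun=> 0) ?cint_cst ?mulr0 //.
    by apply/funext => t; rewrite /Defs.polyn big_ord0 mul0r.
  have E t : Defs.polyn m.+1 c (x * expi t) * echar (- n%:Z) t =
      Defs.polyn m c (x * expi t) * echar (- n%:Z) t +
      (c m * x ^+ m) * echar (m%:Z - n%:Z) t.
    rewrite polyn_recr mulrDl; congr (_ + _).
    rewrite exprMn expiX /echar intrD mulrDl expiD; ring.
  rewrite (cint_eq E) cintD; last 2 first.
  - by apply: ccont_integrand; [exact: entire_analytic (polyn_entire m c)|exact: half_inD].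
  - by apply: ccontM; [exact: ccont_cst|exact: ccont_echar].
  rewrite IH big_ord_recr /= cintZ; last exact: ccont_echar.
  by rewrite cint_echar subr_eq0 eqz_nat.
have pV : (p^-1)%:C * p%:C = 1 :> C by rewrite -rmorphM mulVf.
case: ltnP => [nm|mn].
  rewrite (bigD1 (Ordinal nm)) //= eqxx big1 ?addr0; last first.
    by move=> i; rewrite -val_eqE /= => /negPf ->; rewrite mulr0.
  by rewrite mulrCA pV mulr1.
rewrite big1 ?mulr0 ?mul0r // => i _.
by rewrite ltn_eqF ?mulr0 // (leq_trans (ltn_ord i)).
Qed.

End Coefficients.

(** * Taylor coefficients of elements of X and of entire functions *)

Section SpaceOfAnalyticFunctions.
Variables (R : realType) (X : BanachSpaceD R).
Local Notation C := R[i].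
Local Notation w := (nrm_mono X).
Implicit Types (z l : C) (f g F G : C -> C) (c : nat -> C) (n m : nat).

Lemma circle_bounded F (r : R) : 0 <= r -> (forall z, cabs z = r -> cdiff F z) ->
  exists2 B, 0 < B & forall z, cabs z = r -> cabs (F z) <= B.
Proof.
move=> r0 dF; have cr t : cabs (r%:C * expi t) = r.
  by rewrite cabsM cabs_expi mulr1 cabs_real ger0_norm.
have [cRe cIm] := ccont_circle (fun t => dF _ (cr t)).
have [B1 B10 H1] := @continuous_bounded R _ (- pi) pi cRe.
have [B2 B20 H2] := @continuous_bounded R _ (- pi) pi cIm.
exists (B1 + B2) => [|z zr]; first exact: addr_gt0.
have [t [tpi]] := polar z; rewrite zr => ->.
by apply: (le_trans (cabs_le_ReIm _)); apply: lerD; [exact: H1|exact: H2].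
Qed.

Lemma tcoef_eqD f g n : (forall z, inD z -> f z = g z) -> tcoef f n = tcoef g n.
Proof.
move=> fg; congr (_ * _); rewrite /fourier /conv_op; congr (_ * _).
by apply: cint_eq => t; rewrite fg //; apply: inD_rot; exact: half_inD.
Qed.

Lemma inX_ext f g : (forall z, inD z -> f z = g z) -> inX X f -> inX X g.
Proof. by move=> /(ext X) [[H _] _]; exact: H. Qed.

Lemma nrm_ext f g : (forall z, inD z -> f z = g z) -> nrm X f = nrm X g.
Proof. by move=> /(ext X) []. Qed.

Lemma inXB f g : inX X f -> inX X g -> inX X (fun z => f z - g z).
Proof.
move=> hf /(inXZ (-1)) hg; apply: inX_ext (inXD hf hg) => z _.
by rewrite mulN1r.
Qed.

Lemma polyn_inX n c : inX X (Defs.polyn n c).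
Proof. by apply: entire_inX; exact: polyn_entire. Qed.

Lemma nrm_triangleB f g h : inX X f -> inX X g -> inX X h ->
  nrm X (fun z => f z - h z) <= nrm X (fun z => f z - g z) + nrm X (fun z => g z - h z).
Proof.
move=> hf hg hh.
rewrite (@nrm_ext _ (fun z => (f z - g z) + (g z - h z))); last by move=> z _; ring.
by apply: nrm_triangle; exact: inXB.
Qed.

Lemma nrmBC f g : inX X f -> inX X g ->
  nrm X (fun z => f z - g z) = nrm X (fun z => g z - f z).
Proof.
move=> hf hg; rewrite (@nrm_ext _ (fun z => (-1) * (g z - f z))).
  by rewrite nrmZ ?cabsN ?cabs1 ?mul1r //; exact: inXB.
by move=> z _; ring.
Qed.

Lemma mono_entire n : entire (fun z : C => z ^+ n).
Proof. by move=> z; exact: cdiffX. Qed.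

Lemma nrm_mono_gt0 n : 0 < w n.
Proof.
have hX : inX X (fun z => z ^+ n) by exact: entire_inX (mono_entire n).
rewrite lt0r (nrm_ge0 hX) andbT; apply/eqP => /(nrm_eq0 hX) /(_ _ (half_inD R)) H.
by have := half_expn R n; rewrite H mul0r => /esym/eqP; rewrite oner_eq0.
Qed.

Lemma fourier_inX f k : inX X f -> inX X (fourier f k).
Proof. by move=> hf; apply: conv_inX => //; apply: L1_ccont; exact: ccont_echar. Qed.

(* Rotating the argument multiplies [fourier f (- n)] by the character
   e^{ins}, so its quotient by z^n is rotation invariant; being complex
   differentiable, it is constant. *)
Lemma fourier_negz f n z : inX X f -> inD z ->
  fourier f (- n%:Z) z = tcoef f n * z ^+ n.
Proof.
move=> hf; set a := fourier f (- n%:Z).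
have da : analytic_in_D a by apply: analytic; exact: fourier_inX.
have [k Hk] : exists k, forall u, u != 0 -> inD u -> a u * (u^-1) ^+ n = k.
  apply: rot_inv_cst => [u u0 uD|u s u0 uD].
    apply: cdiffM; first exact: da.
    elim: (n) => [|m IH]; first exact: cdiff_cst.
    have -> : (fun y : C => y^-1 ^+ m.+1) = (fun y => y^-1 * y^-1 ^+ m).
      by apply/funext => y; rewrite exprS.
    by apply: cdiffM => //; exact: cdiffV.
  rewrite /a fourier_rot //; last exact: (analytic hf).
  have -> : expi (- ((- n%:Z)%:~R * s)) = expi s ^+ n :> C.
    by rewrite expiX intrN mulNr opprK.
  rewrite invfM exprMn (exprVn (expi s)).
  have : expi s ^+ n != 0 :> C by rewrite expf_neq0 // expi_neq0.
  set e := expi s ^+ n; set U := u^-1 ^+ n; set A := fourier _ _ u => e0.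
  by field.
have E u : inD u -> a u = k * u ^+ n.
  have H0 v : v != 0 -> inD v -> a v - k * v ^+ n = 0.
    move=> v0 vD; rewrite -(Hk v v0 vD) -mulrA -exprMn mulVf // expr1n mulr1.
    by rewrite subrr.
  move=> uD; apply/eqP; rewrite -subr_eq0; apply/eqP.
  have [->|u0] := eqVneq u 0; last exact: H0.
  apply: (@eq0_of_punctured R (fun v => a v - k * v ^+ n)) => //.
  have -> : (fun v => a v - k * v ^+ n) = (fun v => a v + (- k) * v ^+ n).
    by apply/funext => v; rewrite mulNr.
  apply: cdiffD; first by apply: da; rewrite /inD cabs0 ltr01.
  by apply: cdiffM; [exact: cdiff_cst|exact: cdiffX].
by move=> zD; rewrite (tcoef_intro (E _ (half_inD R))) E.
Qed.

(** The product of this function with z^(m+1) is rotation invariant, hence constant off 0; being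
    continuous with value 0 at the origin, it vanishes. *)
Lemma fourier_posz f m z : inX X f -> inD z -> fourier f m.+1%:Z z = 0.
Proof.
move=> hf; set a := fourier f m.+1%:Z.
have da : analytic_in_D a by apply: analytic; exact: fourier_inX.
have D0 : inD (0 : C) by rewrite /inD cabs0 ltr01.
have [k Hk] : exists k, forall u, u != 0 -> inD u -> a u * u ^+ m.+1 = k.
  apply: rot_inv_cst => [u u0 uD|u s u0 uD].
    by apply: cdiffM; [exact: da|exact: cdiffX].
  rewrite /a fourier_rot //; last exact: (analytic hf).
  have : expi (- (m.+1%:Z%:~R * s)) * expi s ^+ m.+1 = 1 :> C.
    by rewrite expiX -expiD addNr expi0.
  rewrite exprMn; set e := expi s ^+ _; set e' := expi (- _).
  set U := u ^+ m.+1; set A := fourier _ _ u => ee.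
  by transitivity (e' * e * (A * U)); [ring|rewrite ee mul1r].
have k0 : k = 0.
  have := @eq0_of_punctured R (fun v => a v * v ^+ m.+1 + (- k)).
  rewrite expr0n mulr0 add0r => H; rewrite -[k]opprK; apply/eqP.
  rewrite oppr_eq0; apply/eqP; apply: H.
    apply: cdiffD; last exact: cdiff_cst.
    by apply: cdiffM; [exact: da|exact: cdiffX].
  by move=> v v0 vD; rewrite Hk // subrr.
have H0 v : v != 0 -> inD v -> a v = 0.
  move=> v0 vD; apply/eqP; have /eqP := Hk v v0 vD.
  by rewrite k0 mulf_eq0 expf_eq0 (negPf v0) andbF orbF.
have [->|z0] := eqVneq z 0; last exact: H0.
by move=> _; apply: eq0_of_punctured H0; exact: da.
Qed.

Lemma tcoef_nrm f n : inX X f -> cabs (tcoef f n) * w n <= nrm X f.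
Proof.
move=> hf; rewrite /nrm_mono -nrmZ; last exact: entire_inX (mono_entire n).
rewrite -(@nrm_ext (fourier f (- n%:Z))); last by move=> z; exact: fourier_negz.
rewrite -[nrm X f]mul1r -(L1norm_echar R (- n%:Z)).
by apply: conv_nrm => //; apply: L1_ccont; exact: ccont_echar.
Qed.

Lemma tcoef_cauchy f n (r B : R) : inX X f -> 0 <= r < 1 ->
  (forall z, cabs z = r -> cabs (f z) <= B) -> cabs (tcoef f n) * r ^+ n <= 2 * B.
Proof.
move=> hf /andP[r0 r1] HB.
have ar : cabs (r%:C : C) = r by rewrite cabs_real ger0_norm.
have rD : inD (r%:C : C) by rewrite /inD ar.
have := @conv_op_bound R f (- n%:Z) r%:C B (analytic hf) rD.
by rewrite fourier_negz // cabsM cabsX ar; exact.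
Qed.

(** All Fourier coefficients vanish on the circle through z. As [fourier_uniqueness] concerns the
    angle pi, the circle is parametrized from -z. *)
Lemma tcoef_eq0 f z : inX X f -> (forall n, tcoef f n = 0) -> inD z -> f z = 0.
Proof.
move=> hf H zD; have nzD : inD (- z) by rewrite /inD cabsN.
have df := analytic hf.
have -> : f z = f ((- z) * expi pi) by rewrite expipi mulrN1 opprK.
apply: (@fourier_uniqueness R (fun t => f (- z * expi t))).
  by apply: ccont_circle => t; apply: df; exact: inD_rot.
move=> k; have F0 : fourier f k (- z) = 0.
  case: k => [[|n]|n].
  - by have := @fourier_negz f 0 _ hf nzD; rewrite oppr0 H mul0r.
  - exact: fourier_posz.
  - by rewrite NegzE fourier_negz // H mul0r.
apply/eqP; move/eqP: F0; rewrite /fourier /conv_op mulf_eq0 => /orP[|//].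
by move=> /eqP/(congr1 (@cabs R))/eqP; rewrite cabs0 cabs_real normr_eq0 invr_eq0 gt_eqF // twopi_gt0.
Qed.

Lemma tcoef_inj f g z : inX X f -> inX X g ->
  (forall n, tcoef f n = tcoef g n) -> inD z -> f z = g z.
Proof.
move=> hf hg H zD; apply/eqP; rewrite -subr_eq0; apply/eqP.
apply: (@tcoef_eq0 (fun z => f z - g z)) => //; first exact: inXB.
by move=> n; rewrite (tcoefB n (analytic hf) (analytic hg)) H subrr.
Qed.

Lemma entire_scale F (a : C) : entire F -> entire (fun z => F (a * z)).
Proof. by move=> H z; apply: cdiff_scale; exact: H. Qed.

(** Both coefficients are compared at a radius [r] so small that [r] and [a * r] are below 1, since
    [fourier_negz] holds only in D. *)
Lemma tcoef_scale F (a : R) n : entire F -> 0 < a ->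
  tcoef (fun z => F (a%:C * z)) n = a%:C ^+ n * tcoef F n.
Proof.
move=> eF a0; have hF := entire_inX X eF.
have hFa := entire_inX X (entire_scale a%:C eF).
have a1 : 0 < a + 1 by lra.
pose r := (2 * (a + 1))^-1.
have r0 : 0 < r by rewrite invr_gt0 mulr_gt0.
have rr : r * (2 * (a + 1)) = 1 by rewrite mulVf // gt_eqF // mulr_gt0.
have r1 : inD (r%:C : C) by rewrite /inD cabs_real gtr0_norm //; nra.
have r2 : inD (a%:C * r%:C : C).
  by rewrite /inD -rmorphM cabs_real gtr0_norm ?mulr_gt0 //; nra.
have rn : (r%:C : C) ^+ n != 0.
  by rewrite expf_neq0 // -cabs_eq0 cabs_real normr_eq0 gt_eqF.
apply: (mulIf rn); rewrite -(fourier_negz n hFa r1) mulrAC -exprMn mulrC.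
rewrite -(fourier_negz n hF r2); congr (_ * _).
by apply: cint_eq => t; rewrite mulrA.
Qed.

(** Rescaling by some a > |z| moves the point into D, and the coefficients of the rescaled functions
    are determined on D. *)
Lemma entire_eq F G : entire F -> entire G -> (forall z, inD z -> F z = G z) ->
  forall z, F z = G z.
Proof.
move=> eF eG FG z; pose a := cabs z + 1.
have a0 : 0 < a by have := cabs_ge0 z; rewrite /a; lra.
have aC : a%:C != 0 :> C by rewrite -cabs_eq0 cabs_real normr_eq0 gt_eqF.
have -> : z = a%:C * (z / a%:C) by rewrite mulrC divfK.
apply: (@tcoef_inj (fun y => F (a%:C * y)) (fun y => G (a%:C * y))).
- exact: entire_inX (entire_scale _ eF).
- exact: entire_inX (entire_scale _ eG).
- by move=> n; rewrite !tcoef_scale // (tcoef_eqD n FG).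
- rewrite /inD cabsM cabsV cabs_real gtr0_norm // ltr_pdivrMr // mul1r.
  by rewrite /a ltrDl.
Qed.

(** On |z| = 1/2 the m-th partial sum is within 4B/2^m of the series, and extracting the n-th
    coefficient there costs a factor 2 * 2^n; m is then taken large. *)
Lemma tcoef_pser c n : superexp c -> tcoef (pser c) n = c n.
Proof.
move=> Hc; have hp := entire_inX X (pser_entire Hc).
have [B B0 HB] := superexp_bound Hc ltr01.
apply/eqP; rewrite -subr_eq0 -cabs_eq0 eq_le cabs_ge0 andbT.
apply/ler_addgt0Pl => e e0; rewrite addr0.
have [N HN] : exists N, forall m, (N <= m)%N ->
    (2^-1 : R) ^+ m < e / (8 * B * 2 ^+ n).
  apply: expr_small; first by rewrite invr_ge0 ler0n /= invf_lt1 // ltr1n.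
  by rewrite divr_gt0 // !mulr_gt0 ?exprn_gt0.
pose m := maxn N n.+1.
have mN := HN m (leq_maxl _ _).
have nm : (n < m)%N by exact: leq_maxr.
have := @tcoef_cauchy (fun z => pser c z - Defs.polyn m c z) n 2^-1
  (4 * B / 2 ^+ m) (inXB hp (polyn_inX _ _)).
rewrite tcoefB ?tcoef_polyn ?nm; last 2 first.
- exact: entire_analytic (pser_entire Hc).
- exact: entire_analytic (polyn_entire _ _).
rewrite invr_ge0 ler0n invf_lt1 // ltr1n => /(_ erefl) H.
have {H} : cabs (tcoef (pser c) n - c n) * 2^-1 ^+ n <= 2 * (4 * B / 2 ^+ m).
  apply: H => z zr; rewrite cabsC.
  have h0 : 0 <= 2^-1 :> R by rewrite invr_ge0.
  have HB' k : cabs (c k) * (2 * 2^-1) ^+ k <= B by rewrite mulfV.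
  have zr' : cabs z <= 2^-1 by rewrite zr.
  by have [_ ] := pser_approx h0 (ltW B0) HB' zr'.
move=> H; move: mN; rewrite ltr_pdivlMr; last by rewrite !mulr_gt0 ?exprn_gt0.
move: H; rewrite exprVn ler_pdivrMr ?exprn_gt0 // exprVn => H1 H2.
apply: (le_trans H1); apply: ltW; apply: le_lt_trans H2.
by rewrite le_eqVlt; apply/orP; left; apply/eqP; ring.
Qed.

End SpaceOfAnalyticFunctions.

(** * Best approximation and the size of the norms of monomials *)

Section BestApproximation.
Variables (R : realType) (X : BanachSpaceD R).
Local Notation C := R[i].
Local Notation w := (nrm_mono X).
Implicit Types (z l : C) (f g F G : C -> C) (c : nat -> C) (n m : nat).

Lemma nrm_polynB m n c : (m <= n)%N ->
  nrm X (fun z => Defs.polyn n c z - Defs.polyn m c z) <=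
  \sum_(m <= k < n) cabs (c k) * w k.
Proof.
elim: n => [|n IH].
  rewrite leqn0 => /eqP ->; rewrite big_geq //.
  rewrite (@nrm_ext _ X _ (fun z => 0 * Defs.polyn 0 c z)); last first.
    by move=> z _; rewrite subrr mul0r.
  by rewrite nrmZ ?cabs0 ?mul0r //; exact: polyn_inX.
rewrite leq_eqVlt => /predU1P[->|mn].
  rewrite big_geq // (@nrm_ext _ X _ (fun z => 0 * Defs.polyn 0 c z)); last first.
    by move=> z _; rewrite subrr mul0r.
  by rewrite nrmZ ?cabs0 ?mul0r //; exact: polyn_inX.
rewrite big_nat_recr //=.
rewrite (@nrm_ext _ X _ (fun z => (Defs.polyn n c z - Defs.polyn m c z) + c n * z ^+ n)); last first.
  by move=> z _; rewrite polyn_recr addrAC.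
have mX : inX X (fun z => z ^+ n) by exact: entire_inX (@mono_entire R n).
apply: (le_trans (nrm_triangle (inXB (polyn_inX _ _ _) (polyn_inX _ _ _)) (inXZ (c n) mX))).
by rewrite nrmZ //; apply: lerD => //; exact: IH.
Qed.

(** The partial sums are Cauchy, and their limit has the prescribed coefficients because [tcoef_nrm]
    makes each coefficient continuous in the norm. *)
Lemma series_inX c (B : R) n0 : 0 < B ->
  (forall k, (n0 <= k)%N -> cabs (c k) * w k <= B / 2 ^+ k) ->
  exists h, [/\ inX X h, forall k, tcoef h k = c k &
    forall n, (n0 <= n)%N -> nrm X (fun z => h z - Defs.polyn n c z) <= 2 * B / 2 ^+ n].
Proof.
move=> B0 H; pose S n := Defs.polyn n c.
have SX n : inX X (S n) by exact: polyn_inX.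
have tail m n : (n0 <= m)%N -> (m <= n)%N ->
    nrm X (fun z => S n z - S m z) <= 2 * B / 2 ^+ m.
  move=> nm mn; apply: (le_trans (nrm_polynB c mn)); apply: geo_sum; first exact: ltW.
  by move=> k mk; apply: H; exact: leq_trans mk.
have small e : 0 < e -> exists N, forall n, (N <= n)%N -> 2 * B / 2 ^+ n < e.
  move=> e0; have B2 : 0 < 2 * B by rewrite mulr_gt0.
  have [|N HN] := @expr_small R 2^-1 (e / (2 * B)) _ (divr_gt0 e0 B2).
    by rewrite invr_ge0 ler0n /= invf_lt1 // ltr1n.
  by exists N => n /HN; rewrite exprVn ltr_pdivlMr // mulrC.
have [h [hX lim]] : exists h, inX X h /\ forall e : R, 0 < e ->
    exists N, forall n, (N <= n)%N -> nrm X (fun z => S n z - h z) < e.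
  apply: complete => // e /small[N HN]; exists (maxn n0 N) => m n.
  wlog mn : m n / (m <= n)%N.
    move=> W hm hn; have [mn|/ltnW nm] := leqP m n; first exact: W.
    by rewrite nrmBC //; exact: W.
  rewrite !geq_max => /andP[nm Nm] _; rewrite nrmBC //.
  by apply: le_lt_trans (HN m Nm); exact: tail.
exists h; split=> // [k|n nn].
  apply/eqP; rewrite -subr_eq0 -cabs_eq0 eq_le cabs_ge0 andbT.
  apply/ler_addgt0Pl => e e0; rewrite addr0.
  have [N HN] := lim _ (mulr_gt0 e0 (nrm_mono_gt0 X k)).
  have := HN _ (leq_maxl N k.+1); rewrite nrmBC // => /ltW H1.
  have := @tcoef_nrm R X _ k (inXB hX (SX (maxn N k.+1))).
  rewrite (tcoefB k (analytic hX) (analytic (SX _))) tcoef_polyn leq_maxr.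
  by move=> H2; have := le_trans H2 H1; rewrite ler_pM2r // nrm_mono_gt0.
apply/ler_addgt0Pl => e /lim[N HN].
apply: (le_trans (nrm_triangleB hX (SX (maxn N n)) (SX n))).
apply: lerD; last by apply: tail => //; exact: leq_maxr.
by rewrite nrmBC // ltW // HN // leq_maxl.
Qed.

Lemma En_le n f c : inX X f -> En X n f <= nrm X (fun z => f z - Defs.polyn n c z).
Proof.
move=> hf; apply: ge_inf; last by exists c.
exists 0 => _ [d _ <-]; apply: nrm_ge0; exact: inXB (polyn_inX _ _ _).
Qed.

Lemma En_ge n f (b : R) : inX X f ->
  (forall c, b <= nrm X (fun z => f z - Defs.polyn n c z)) -> b <= En X n f.
Proof.
move=> hf H; apply: lb_le_inf; first by exists (nrm X (fun z => f z - Defs.polyn n (fun=> 0) z)), (fun=> 0).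
by move=> _ [d _ <-].
Qed.

Lemma En_ge0 n f : inX X f -> 0 <= En X n f.
Proof. by move=> hf; apply: En_ge => // c; apply: nrm_ge0; exact: inXB (polyn_inX _ _ _). Qed.

Lemma tcoef_En n f : inX X f -> cabs (tcoef f n) * w n <= En X n f.
Proof.
move=> hf; apply: En_ge => // c.
have := @tcoef_nrm R X _ n (inXB hf (polyn_inX X n c)).
by rewrite (tcoefB n (analytic hf) (analytic (polyn_inX X n c))) tcoef_polyn ltnn subr0.
Qed.

Lemma En_decr n f : inX X f -> En X n.+1 f <= En X n f.
Proof.
move=> hf; apply: En_ge => // c.
apply: (le_trans (@En_le n.+1 f (fun k => if (k < n)%N then c k else 0) hf)).
rewrite (@nrm_ext _ X _ (fun z => f z - Defs.polyn n c z)) // => z _.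
rewrite polyn_recr ltnn mul0r addr0; congr (_ - _).
by apply: eq_bigr => i _; rewrite ltn_ord.
Qed.

(** The Taylor series converges in X to an element with the coefficients of f, hence equal to f on
    D; the Taylor polynomial therefore competes in the infimum. *)
Lemma En_tail f n (B : R) : inX X f -> 0 < B ->
  (forall k, (n <= k)%N -> cabs (tcoef f k) * w k <= B / 2 ^+ k) ->
  En X n f <= 2 * B / 2 ^+ n.
Proof.
move=> hf B0 H; have [h [hX hc /(_ n (leqnn n)) hn]] := series_inX B0 H.
apply: (le_trans (En_le n (tcoef f) hf)).
rewrite (@nrm_ext _ X _ (fun z => h z - Defs.polyn n (tcoef f) z)) // => z zD.
by congr (_ - _); exact: (tcoef_inj hf hX (fun k => esym (hc k)) zD).
Qed.

(* If ||z^n|| < 8^-n infinitely often, then the series of 4^n z^n over those n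
   converges in X, although its radius of convergence is at most 1/4. *)
Lemma nrm_mono_ge : exists N, forall n, (N <= n)%N -> (8 ^+ n)^-1 <= w n.
Proof.
pose c n : C := if w n < (8 ^+ n)^-1 then (4 ^+ n : R)%:C else 0.
have [k _|h [hX hc _]] := @series_inX c 1 0 ltr01.
  rewrite /c; case: ifP => [/ltW H|_]; last first.
    by rewrite cabs0 mul0r divr_ge0 // exprn_ge0.
  rewrite cabs_real ger0_norm ?exprn_ge0 //.
  have -> : 1 / 2 ^+ k = 4 ^+ k * (8 ^+ k)^-1 :> R.
    have -> : (8 : R) = 4 * 2 by ring.
    by rewrite exprMn; field; rewrite !expf_neq0.
  by rewrite ler_wpM2l // exprn_ge0.
(* On |z| = 1/2 the coefficient 4^n contributes 2^n, which outgrows the Cauchy bound 2B. *)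
have [||B B0 HB] := @circle_bounded R h 2^-1.
- by rewrite invr_ge0.
- by move=> z zr; apply: (analytic hX); rewrite /inD zr invf_lt1 // ltr1n.
have [||N HN] := @expr_small R 2^-1 (2 * B + 1)^-1.
- by rewrite invr_ge0 ler0n /= invf_lt1 // ltr1n.
- by rewrite invr_gt0; lra.
exists N => n /HN Nn; rewrite leNgt; apply/negP => wn.
have := @tcoef_cauchy R X h n 2^-1 B hX.
rewrite invr_ge0 ler0n invf_lt1 // ltr1n => /(_ erefl HB).
rewrite hc /c wn cabs_real ger0_norm ?exprn_ge0 //.
have -> : 4 ^+ n * 2^-1 ^+ n = 2 ^+ n :> R.
  rewrite -exprMn; congr (_ ^+ _); by field.
move: Nn; rewrite exprVn ltf_pV2 ?posrE ?exprn_gt0 //; last by lra.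
lra.
Qed.

(* If ||z^n||^(1/n) were unbounded, then n / ||z^n|| along its records would be
   the coefficients of an entire function, contradicting [tcoef_nrm]. *)
Lemma nrm_mono_le : exists2 D : R, 1 <= D & forall n, (0 < n)%N -> w n <= D ^+ n.
Proof.
have w0 := nrm_mono_gt0 X.
pose s n : R := w n `^ n%:R^-1.
have s0 n : 0 < s n by rewrite powR_gt0.
have sn n : (0 < n)%N -> s n ^+ n = w n.
  move=> n0; rewrite -powR_mulrn ?(ltW (s0 n)) // -powRrM mulVf ?powRr1 ?(ltW (w0 n)) //.
  by rewrite pnatr_eq0 -lt0n.
have [[D HD]|unb] := pselect (exists D, forall n, (0 < n)%N -> s n <= D).
  exists (1 + `|D|); first by rewrite lerDl.
  move=> n n0; rewrite -sn //; apply: lerXn2r; rewrite ?nnegrE ?(ltW (s0 n)) ?addr_ge0 //.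
  by apply: (le_trans (HD n n0)); have := ler_norm D; lra.
exfalso.
have ex D : exists n, ((0 < n)%N && (D < s n)).
  apply: contrapT => H; apply: unb; exists D => n n0; rewrite leNgt.
  by apply/negP => Dn; apply: H; exists n; rewrite n0.
pose T n := (0 < n)%N /\ forall m, (0 < m < n)%N -> s m < s n.
pose c n : C := if `[< T n >] then (n%:R / w n)%:C else 0.
have Hc : superexp c.
  move=> r r0; have [m /andP[m0 Hm]] := ex (2 * r); exists m.+1 => n mn.
  rewrite /c; case: asboolP => [[n0 Tn]|_]; last by rewrite cabs0 mul0r.
  (* A record that comes after an index where [s] exceeds 2r exceeds 2r itself, so the n-th term is
     at most n/2^n. *)
  have rs : 2 * r <= s n by apply/ltW/(lt_trans Hm)/Tn; rewrite m0.
  rewrite cabs_real ger0_norm ?divr_ge0 ?(ltW (w0 n)) //.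
  rewrite mulrAC ler_pdivrMr ?w0 // mul1r -sn //.
  apply: (@le_trans _ _ ((2 * r) ^+ n)).
    rewrite exprMn ler_wpM2r ?exprn_ge0 ?(ltW r0) //.
    by rewrite -natrX ler_nat ltnW // ltn_expl.
  by apply: lerXn2r; rewrite ?nnegrE ?(ltW (s0 n)) // mulr_ge0 // ltW.
have pX := entire_inX X (pser_entire Hc).
set K := nrm X (pser c) in pX *.
have TK n : T n -> n%:R <= K.
  move=> Tn; have := tcoef_nrm n pX; rewrite (tcoef_pser X) // /c asboolT //.
  by rewrite cabs_real ger0_norm ?divr_ge0 ?(ltW (w0 n)) // divfK ?gt_eqF.
(* Every record index is at most [K]. But the least positive index where [s] exceeds a bound [M] for
   its first [k] values is a record, and it is at least [k > K]. *)
pose k := (Num.truncn K).+1.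
have Kk : K < k%:R by rewrite truncnS_gt.
pose M := \sum_(j < k) s j.
have sM j : (j < k)%N -> s j <= M.
  move=> jk; rewrite /M (bigD1 (Ordinal jk)) //= lerDl.
  by apply: sumr_ge0 => i _; exact: ltW.
case: (ex_minnP (ex M)) => n /andP[n0 Mn] nmin.
have Tn : T n.
  split=> // m /andP[m0 mn]; apply: le_lt_trans Mn; rewrite leNgt; apply/negP => Mm.
  by have := nmin m; rewrite m0 Mm leqNgt mn => /(_ erefl).
have := TK n Tn; apply/negP; rewrite -ltNge; apply: (lt_le_trans Kk).
rewrite ler_nat leqNgt; apply/negP => /sM; rewrite leNgt Mn //.
Qed.

End BestApproximation.

(** * Extracting and proving bounds on a limit superior *)

Section LimitSuperior.
Variable R : realType.
Local Open Scope ereal_scope.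

Lemma limf_esup_lt (T : choiceType) (Y : filteredType T) (u : Y -> \bar R)
    (F : set_system Y) (a : \bar R) :
  limf_esup u F < a -> exists2 V, F V & forall x, V x -> u x < a.
Proof.
move=> /ereal_inf_lt [_ [V FV <-] Va]; exists V => // x Vx.
by apply: le_lt_trans Va; apply: ereal_sup_ubound; exists x.
Qed.

Lemma limf_esup_le (T : choiceType) (Y : filteredType T) (u : Y -> \bar R)
    (F : set_system Y) (a : \bar R) V :
  F V -> (forall x, V x -> u x <= a) -> limf_esup u F <= a.
Proof.
move=> FV H; apply: (@le_trans _ _ (ereal_sup (u @` V))).
  by apply: ereal_inf_lbound; exists V.
by apply: ge_ereal_sup => _ [x Vx <-]; exact: H.
Qed.

(** The rates divide by s, so s must be positive even if [a] is negative or -oo. *)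
Lemma ereal_between (a : \bar R) (rho : R) : (0 < rho)%R -> a < rho%:E ->
  exists s : R, [/\ (0 < s)%R, (s < rho)%R & a < s%:E].
Proof.
move=> r0; case: a => [a| |] //; last by exists (rho / 2)%R; split; rewrite ?ltNyr //; lra.
rewrite lte_fin => ar; have m0 : (Num.max a 0 < rho)%R by rewrite gt_max ar.
have ma : (a <= Num.max a 0)%R by rewrite le_max lexx.
have mz : (0 <= Num.max a 0)%R by rewrite le_max lexx orbT.
exists ((Num.max a 0 + rho) / 2)%R; rewrite lte_fin; split; lra.
Qed.

Lemma ereal_le_of_gt (a : \bar R) (rho : R) :
  (forall s : R, (rho < s)%R -> a <= s%:E) -> a <= rho%:E.
Proof.
move=> H; apply/lee_addgt0Pr => e e0; rewrite -EFinD; apply: H.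
by rewrite ltrDl.
Qed.

End LimitSuperior.

(** * The order of an entire function as a pointwise growth bound *)

Section Growth.
Variables (R : realType).
Local Notation C := R[i].
Implicit Types (F : C -> C) (s r : R) (n : nat).

Definition growth s F := exists r0 : R, forall r, r0 <= r ->
  forall z, cabs z = r -> cabs (F z) <= expR (expR (s * ln r)).

Lemma ln_nat_large (A : R) : exists N, (0 < N)%N /\
  forall n, (N <= n)%N -> A <= ln (n%:R : R).
Proof.
exists (Num.truncn (expR A)).+1; split=> // n Nn.
rewrite -[A]expRK ler_ln ?posrE ?expR_gt0 ?ltr0n ?(leq_trans _ Nn) //.
apply: ltW; apply: (lt_le_trans (truncnS_gt _)).
by rewrite ler_nat.
Qed.

Lemma exists_cabs r : 0 <= r -> exists z : C, cabs z = r.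
Proof. by move=> r0; exists r%:C; rewrite cabs_real ger0_norm. Qed.

Lemma le_maxmod F r z : entire F -> cabs z = r -> cabs (F z) <= maxmod F r.
Proof.
move=> eF zr; apply: ub_le_sup; last by exists z.
have r0 : 0 <= r by rewrite -zr cabs_ge0.
have [B _ HB] := circle_bounded r0 (fun z _ => eF z).
by exists B => _ [y yr <-]; exact: HB.
Qed.

Lemma order_lt_growth F s : entire F -> (order_of F < s%:E)%E -> growth s F.
Proof.
move=> eF /limf_esup_lt [V [A [_ HA]] HV]; exists (Num.max (A + 1) 2) => r.
rewrite ge_max => /andP[rA r2] z zr; have /HA/HV : A < r by lra.
have lr : 0 < ln r by apply: ln_gt0; lra.
rewrite lte_fin ltr_pdivrMr // => H; apply: (le_trans (le_maxmod eF zr)).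
have [M1|M1] := leP (maxmod F r) 1.
  by apply: (le_trans M1); rewrite -expR0 ler_expR expR_ge0.
have l0 : 0 < ln (maxmod F r) by exact: ln_gt0.
rewrite -[maxmod F r]lnK ?posrE; last by lra.
rewrite ler_expR -[ln (maxmod F r)]lnK ?posrE // ler_expR.
exact: ltW.
Qed.

Lemma growth_order_le F s : 0 <= s -> growth s F -> (order_of F <= s%:E)%E.
Proof.
move=> s0 [r0 H]; apply: (@limf_esup_le R _ _ _ _ _ [set r | Num.max r0 2 < r]).
  by exists (Num.max r0 2); split; [exact: num_real|].
move=> r /=; rewrite gt_max => /andP[/ltW rr r2].
have lr : 0 < ln r by apply: ln_gt0; lra.
rewrite lee_fin ler_pdivrMr //.
have [M1|M1] := leP (maxmod F r) 1.
  (* The inner logarithm is at most 0 here and [ln] is 0 at such arguments, so the quotient is 0;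
     this is where [0 <= s] enters. *)
  rewrite [ln (ln _)]ln0; first by rewrite mulr_ge0 // ltW.
  exact: ln_le0.
have l0 : 0 < ln (maxmod F r) by exact: ln_gt0.
have ME : maxmod F r <= expR (expR (s * ln r)).
  apply: ge_sup.
    by have [|z zr] := @exists_cabs r; [lra|exists (cabs (F z)), z].
  by move=> _ [z zr <-]; exact: H zr.
rewrite -ler_expR lnK ?posrE // -ler_expR lnK ?posrE //; lra.
Qed.

(* The substitution r = e^y reduces this to a + b y <= e^(d y) for large y. *)
Lemma expexp_dominates (s s' A : R) : 0 < s -> s < s' -> 0 < A ->
  exists r0 : R, forall r, r0 <= r ->
    A * expR (expR (s * ln (2 * r)) * ln (2 * r)) <= expR (expR (s' * ln r)).
Proof.
move=> s0 ss A0; pose d := s' - s; have d0 : 0 < d by rewrite /d; lra.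
pose l2 := ln 2 : R; have l20 : 0 < l2 by rewrite ln_gt0 // ltr1n.
(* Here [b] is 2^s. After logarithms and division by r^s, it suffices to bound |ln A| + b (ln 2 + y)
   by e^{dy}, where y = ln r. *)
pose b := expR (s * l2); have b0 : 0 < b by exact: expR_gt0.
pose a := `|ln A| + b * l2.
have a0 : 0 <= a by rewrite addr_ge0 // mulr_ge0 // ltW.
(* From e^{dy} >= (dy/2)^2 it suffices that (a + b) y <= d^2 y^2 / 4; the added 1 ensures y >= 1. *)
pose y0 := 4 * (a + b) / d ^+ 2 + 1.
exists (expR y0) => r rr.
have r0 : 0 < r by exact: lt_le_trans (expR_gt0 _) rr.
pose y := ln r; have yy : y0 <= y by rewrite /y -[y0]expRK ler_ln ?posrE ?expR_gt0.
have d2 : 0 < d ^+ 2 by rewrite exprn_gt0.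
have y1 : 1 <= y.
  apply: le_trans yy; rewrite /y0 lerDr divr_ge0 ?(ltW d2) //.
  by rewrite mulr_ge0 // addr_ge0 // ltW.
have key : a + b * y <= expR (d * y).
  have H1 : (a + b) * y <= d ^+ 2 * y ^+ 2 / 4.
    have : 4 * (a + b) <= d ^+ 2 * y.
      rewrite -ler_pdivrMl // mulrC; move: yy; rewrite /y0; lra.
    move=> H; have : 4 * (a + b) * y <= d ^+ 2 * y * y by rewrite ler_wpM2r //; lra.
    by rewrite expr2; lra.
  have H2 : 1 + d * y / 2 <= expR (d * y / 2) by exact: expR_ge1Dx.
  have dy : 0 < d * y by rewrite mulr_gt0 //; lra.
  have -> : expR (d * y) = expR (d * y / 2) ^+ 2.
    by rewrite -expRM_natl; congr expR; field.
  have H3 : (d * y / 2) ^+ 2 <= expR (d * y / 2) ^+ 2.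
    by apply: lerXn2r; rewrite ?nnegrE ?expR_ge0 //; lra.
  have E : (d * y / 2) ^+ 2 = d ^+ 2 * y ^+ 2 / 4 by field.
  have : a <= a * y by rewrite ler_peMr.
  by lra.
rewrite lnM ?posrE // -/l2 -/y -{1}[A]lnK ?posrE // -expRD ler_expR.
rewrite (mulrDr s) expRD -/b.
have -> : s' * y = s * y + d * y by rewrite /d; ring.
rewrite expRD; set E := expR (s * y).
have E1 : 1 <= E by rewrite -expR0 ler_expR mulr_ge0 ?(ltW s0) //; lra.
have : ln A <= E * `|ln A|.
  by apply: (le_trans (ler_norm _)); rewrite ler_peMl.
have : E * (a + b * y) <= E * expR (d * y) by rewrite ler_wpM2l //; lra.
by rewrite /a; lra.
Qed.

End Growth.

(** * Growth of F against the decay rate of E_n(f), and the ratio *)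

Section OrderAndApproximation.
Variables (R : realType) (X : BanachSpaceD R).
Local Notation C := R[i].
Local Notation w := (nrm_mono X).
Implicit Types (f F : C -> C) (s r : R) (n : nat).

Definition nlogn n : R := n%:R * ln n%:R.

(** The exponential is n^(-n/s). The product form involves neither quotient nor logarithm, so it
    also covers E_n(f) = 0. *)
Definition En_rate s f n := En X n f <= w n * expR (- (nlogn n / s)).

Lemma nlogn_gt0 n : (1 < n)%N -> 0 < nlogn n.
Proof.
move=> n1; rewrite mulr_gt0 ?ltr0n ?(ltnW n1) //.
by rewrite ln_gt0 // ltr1n.
Qed.

(** The Cauchy estimate at radius r = n^(1/s), where exp(r^s) = e^n, gives |c_n| <= 2 e^n n^(-n/s).
    Summing the tail against D^k and comparing with ||z^n|| >= 8^-n loses only exponential factors,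
    absorbed by passing to [s']. *)
Lemma growth_En_rate f F s s' : inX X f -> entire F ->
  (forall z, inD z -> F z = f z) -> 0 < s -> s < s' -> growth s F ->
  exists N, forall n, (N <= n)%N -> En_rate s' f n.
Proof.
move=> hf eF Ff s0 ss [r0 Hg].
have [D D1 wD] := nrm_mono_le X.
have [N8 w8] := nrm_mono_ge X.
pose d := ln D; have d0 : 0 <= d by exact: ln_ge0.
have DE : D = expR d by rewrite lnK // posrE; lra.
have l2 : 0 < ln (2 : R) by rewrite ln_gt0 // ltr1n.
have l4 : 0 < ln (4 : R) by rewrite ln_gt0 // ltr1n.
have l8 : 0 < ln (8 : R) by rewrite ln_gt0 // ltr1n.
have [N1 [N10 HN1]] := ln_nat_large (s * ln (Num.max r0 1)).
have s'0 : 0 < s' by lra.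
have iss : 0 < s^-1 - s'^-1 by rewrite subr_gt0 ltf_pV2 ?posrE.
(* [N1] makes n^(1/s) at least [r0], [N2] makes the exponent [q] below nonpositive, and [N3] absorbs
   the total exponential loss. *)
have [N2 [N20 HN2]] := ln_nat_large (s * (1 + d + ln 2)).
have [N3 [N30 HN3]] := ln_nat_large ((1 + d + ln 8 + ln 4) / (s^-1 - s'^-1)).
have Hc n : (N1 <= n)%N -> cabs (tcoef f n) <= 2 * expR (n%:R - nlogn n / s).
  move=> /[dup] Nn /HN1 Hn.
  have n0 : (0 < n)%N by exact: leq_trans Nn.
  pose r := expR (ln n%:R / s) : R.
  have rr0 : Num.max r0 1 <= r.
    have m0 : 0 < Num.max r0 1 by rewrite lt_max ltr01 orbT.
    by rewrite -[Num.max _ _]lnK ?posrE // ler_expR ler_pdivlMr // mulrC.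
  have rr : r0 <= r by apply: le_trans rr0; rewrite le_max lexx.
  have rp : 0 < r by exact: expR_gt0.
  have r2 : 0 < 2 * r by lra.
  have Hr : expR (expR (s * ln r)) = expR n%:R.
    rewrite /r expRK mulrC divfK ?gt_eqF // lnK // posrE ltr0n //.
  (* The circle of radius [r] for F becomes the circle of radius 1/2, inside D, for z |-> F(2rz). *)
  have eFr := @entire_scale R F (2 * r)%:C eF.
  have := @tcoef_cauchy R X _ n 2^-1 (expR n%:R) (entire_inX X eFr).
  rewrite invr_ge0 ler0n invf_lt1 // ltr1n => /(_ erefl) H.
  have {H} : cabs (tcoef (fun z => F ((2 * r)%:C * z)) n) * 2^-1 ^+ n <= 2 * expR n%:R.
    apply: H => z zr; rewrite -Hr; apply: Hg => //.
    by rewrite cabsM cabs_real zr gtr0_norm //; field.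
  rewrite (tcoef_scale X) // (tcoef_eqD n Ff) cabsM cabsX cabs_real gtr0_norm //.
  rewrite mulrAC -exprMn; have -> : 2 * r * 2^-1 = r by field.
  have rn : r ^+ n = expR (nlogn n / s).
    by rewrite /r -expRM_natl /nlogn mulrA.
  by rewrite rn mulrC -ler_pdivlMr ?expR_gt0 // -expRN -mulrA -expRD.
exists (maxn (maxn N1 N2) (maxn N3 N8)) => n.
rewrite !geq_max => /andP[/andP[n1 n2] /andP[n3 n8]].
have n0 : (0 < n)%N by exact: leq_trans n1.
have nR : 1 <= (n%:R : R) by rewrite ler1n.
(* The k-th term times 2^k is at most 2 e^{kq} for k >= n, hence at most 2 e^{nq} as q <= 0: this is
   the constant passed to [En_tail]. *)
pose q := 1 + d + ln 2 - ln n%:R / s.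
have q0 : q <= 0.
  by rewrite /q subr_le0 ler_pdivlMr // mulrC; exact: HN2.
have He : 2 ^+ n = expR (n%:R * ln 2) :> R.
  by rewrite expRM_natl lnK // posrE.
have B0 : 0 < 2 * expR (n%:R * q) by rewrite mulr_gt0 ?expR_gt0.
have := En_tail hf B0 _ => /(_ n) H.
rewrite /En_rate; apply: (le_trans (H _)) => {H}.
  move=> k nk; have k0 : (0 < k)%N by exact: leq_trans nk.
  have kn : (n%:R : R) <= k%:R by rewrite ler_nat.
  have H1 := Hc k (leq_trans n1 nk).
  have H2 : w k <= expR (k%:R * d) by rewrite expRM_natl -DE wD.
  have H3 : cabs (tcoef f k) * w k <= 2 * expR (k%:R - nlogn k / s) * expR (k%:R * d).
    by apply: ler_pM => //; [exact: cabs_ge0|exact: ltW (nrm_mono_gt0 _ _)].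
  apply: (le_trans H3); rewrite -mulrA -expRD.
  have -> : 2 ^+ k = expR (k%:R * ln 2) :> R by rewrite expRM_natl lnK // posrE.
  rewrite -mulrA -expRN -expRD ler_wpM2l // ler_expR /nlogn.
  have lkn : ln n%:R <= ln k%:R :> R by rewrite ler_ln ?posrE ?ltr0n.
  have H4 : k%:R * (ln n%:R / s) <= k%:R * ln k%:R / s.
    by rewrite -mulrA ler_wpM2l // ler_wpM2r // invr_ge0 ltW.
  have H5 : k%:R * q <= n%:R * q by rewrite ler_wnM2r.
  by move: H5; rewrite {1}/q; lra.
apply: (@le_trans _ _ (expR (n%:R * - ln 8) * expR (- (nlogn n / s')))); last first.
  rewrite ler_wpM2r ?expR_ge0 //; apply: le_trans (w8 n n8).
  by rewrite mulrN expRN expRM_natl lnK // posrE.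
have -> : 2 * (2 * expR (n%:R * q)) / 2 ^+ n = expR (ln 4 + n%:R * q - n%:R * ln 2).
  rewrite He expRD expRN expRD lnK ?posrE //; ring.
rewrite -expRD ler_expR /q.
have := HN3 n n3; rewrite ler_pdivrMr // => H.
have : n%:R * (1 + d + ln 8 + ln 4) <= n%:R * (ln n%:R * (s^-1 - s'^-1)).
  by rewrite ler_wpM2l.
have : ln 4 <= n%:R * ln 4 :> R by rewrite ler_peMl // ltW.
rewrite /nlogn.
have -> : n%:R * ln n%:R / s' = n%:R * (ln n%:R * s'^-1) :> R by rewrite mulrA.
have -> : n%:R * (ln n%:R * (s^-1 - s'^-1)) =
  n%:R * (ln n%:R / s) - n%:R * (ln n%:R * s'^-1) :> R by ring.
lra.
Qed.

(** At radius 2r the terms split at E = (2r)^s: below it they are at most a constant times (2r)^E,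
    above it n^(1/s) > 2r makes them at most 1. The passage from 2r to r is paid for by [s' > s]. *)
Lemma En_rate_growth f s : inX X f -> 0 < s ->
  (exists N, forall n, (N <= n)%N -> En_rate s f n) ->
  superexp (tcoef f) /\ forall s', s < s' -> growth s' (pser (tcoef f)).
Proof.
move=> hf s0 [N HN].
have Hc n : (N <= n)%N -> cabs (tcoef f n) <= expR (- (nlogn n / s)).
  move=> /HN H; have := le_trans (tcoef_En n hf) H.
  by rewrite mulrC ler_pM2l // nrm_mono_gt0.
have small r n : (N <= n)%N -> (0 < n)%N -> 0 < r -> s * ln r <= ln n%:R ->
    cabs (tcoef f n) * r ^+ n <= 1.
  move=> /Hc H n0 r0 Hr.
  have -> : r ^+ n = expR (n%:R * ln r) by rewrite expRM_natl lnK.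
  apply: (@le_trans _ _ (expR (- (nlogn n / s)) * expR (n%:R * ln r))).
    by rewrite ler_wpM2r // expR_ge0.
  rewrite -expRD -[leRHS]expR0 ler_expR /nlogn addrC subr_le0 -mulrA ler_wpM2l //.
  by rewrite ler_pdivlMr // mulrC.
have Hs : superexp (tcoef f).
  move=> r r0; have [M [M0 HM]] := ln_nat_large (s * ln r).
  exists (maxn N M) => n; rewrite geq_max => /andP[Nn Mn].
  by apply: small => //; [exact: leq_trans Mn|exact: HM].
split=> // s' ss.
have [A A0 HA] := superexp_bound Hs ltr01.
have A4 : 0 < 4 * (A + 1) by lra.
have [r0 Hr0] := expexp_dominates s0 ss A4.
(* For r >= [x0] the threshold [E] is at least N + 1, so every index beyond it obeys the assumed
   rate. *)
pose x0 := expR (N.+1%:R / s) : R.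
exists (Num.max (Num.max r0 1) x0) => r.
rewrite !ge_max => /andP[/andP[rr r1] rx] z zr.
have rp : 0 < r by lra.
have x1 : 1 <= 2 * r by lra.
have lx : 0 <= ln (2 * r) by exact: ln_ge0.
set E := expR (s * ln (2 * r)).
have NE : N.+1%:R <= E.
  have : N.+1%:R <= s * ln (2 * r).
    rewrite mulrC -ler_pdivrMr // -ler_expR lnK ?posrE; last lra.
    by apply: (le_trans rx); lra.
  move=> H; apply: (le_trans H); apply: le_trans (expR_ge1Dx _).
  by rewrite lerDr.
have HB n : cabs (tcoef f n) * (2 * r) ^+ n <= (A + 1) * expR (E * ln (2 * r)).
  have E0 : 1 <= expR (E * ln (2 * r)).
    by rewrite -[leLHS]expR0 ler_expR mulr_ge0 ?expR_ge0.
  have [nE|En'] := leP n%:R E.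
    apply: ler_pM; rewrite ?cabs_ge0 ?exprn_ge0 //; first lra.
      by have := HA n; rewrite expr1n mulr1; lra.
    have -> : (2 * r) ^+ n = expR (n%:R * ln (2 * r)).
      by rewrite expRM_natl lnK // posrE; lra.
    by rewrite ler_expR ler_wpM2r.
  have Nn : (N.+1 <= n)%N by rewrite -(ler_nat R); lra.
  have H1 : cabs (tcoef f n) * (2 * r) ^+ n <= 1.
    apply: small; [exact: ltnW|exact: leq_trans Nn|lra|].
    by rewrite -ler_expR lnK ?posrE ?ltr0n ?(leq_trans _ Nn) //; exact: ltW.
  by apply: (le_trans H1); nra.
have := @pser_bound R (tcoef f) r _ z (ltW rp) _ HB.
rewrite zr => H; apply: le_trans (H _ _) _ => //.
  by rewrite mulr_ge0 ?expR_ge0 //; lra.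
by rewrite mulrA; exact: Hr0.
Qed.

Lemma pser_eq_inD f z : inX X f -> superexp (tcoef f) -> inD z ->
  pser (tcoef f) z = f z.
Proof.
move=> hf Hs; apply: (@tcoef_inj R X _ _ z) => //.
  exact: entire_inX (pser_entire Hs).
by move=> n; exact: (tcoef_pser X).
Qed.

Lemma En_rate_lt f s n : 0 < s -> (1 < n)%N -> En_rate s f n -> En X n f < w n.
Proof.
move=> s0 n1 H; apply: (le_lt_trans H); rewrite gtr_pMr ?nrm_mono_gt0 //.
by rewrite -[ltRHS]expR0 ltr_expR oppr_lt0 divr_gt0 // nlogn_gt0.
Qed.

(** For n > 1 the rate forces a positive logarithm, so the inequality can be inverted; E_n(f) = 0
    falls under the convention that the ratio is 0. *)
Lemma ratio_term_le f s n : inX X f -> 0 < s -> (1 < n)%N -> En_rate s f n ->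
  (ratio_term X f n <= s%:E)%E.
Proof.
move=> hf s0 n1 H; rewrite /ratio_term; case: ifPn => [_|E0].
  by rewrite lee_fin ltW.
have Ep : 0 < En X n f by rewrite lt0r E0 En_ge0.
have L : nlogn n / s <= ln (w n / En X n f).
  rewrite -ler_expR lnK ?posrE ?divr_gt0 ?nrm_mono_gt0 //.
  rewrite ler_pdivlMr // mulrC -ler_pdivlMr ?expR_gt0 // -expRN; exact: H.
have L0 : 0 < ln (w n / En X n f).
  by apply: lt_le_trans L; rewrite divr_gt0 // nlogn_gt0.
by rewrite gt_eqF // lee_fin ler_pdivrMr // [leRHS]mulrC -ler_pdivrMr.
Qed.

(** [En X n f < w n] makes the logarithm positive; a negative ratio would lie below [s] without
    implying any decay. *)
Lemma ratio_term_lt f s n : inX X f -> 0 < s -> En X n f < w n ->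
  (ratio_term X f n < s%:E)%E -> En_rate s f n.
Proof.
move=> hf s0 Ew; rewrite /ratio_term /En_rate; case: ifPn => [/eqP -> _|E0].
  by rewrite mulr_ge0 ?expR_ge0 // ltW // nrm_mono_gt0.
have Ep : 0 < En X n f by rewrite lt0r E0 En_ge0.
have q1 : 1 < w n / En X n f by rewrite ltr_pdivlMr // mul1r.
have L0 : 0 < ln (w n / En X n f) by exact: ln_gt0.
rewrite gt_eqF // lte_fin ltr_pdivrMr // => H.
rewrite expRN ler_pdivlMr ?expR_gt0 // mulrC -ler_pdivlMr //.
rewrite -[leRHS]lnK ?posrE; last lra.
by rewrite ler_expR ler_pdivrMr // [leRHS]mulrC ltW.
Qed.

Lemma ratio_term_gt0 f n : inX X f -> (1 < n)%N ->
  (0 < ratio_term X f n < +oo)%E -> En X n f < w n.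
Proof.
move=> hf n1; rewrite /ratio_term; case: ifPn => [_|E0]; first by rewrite ltxx.
have Ep : 0 < En X n f by rewrite lt0r E0 En_ge0.
case: ifPn => [_|L0]; first by rewrite ltxx andbF.
rewrite lte_fin pmulr_rgt0 ?nlogn_gt0 // invr_gt0 => /andP[H _].
have := H; rewrite ltNge => /negP K; rewrite ltNge; apply/negP => wE; apply: K.
by apply: ln_le0; rewrite ler_pdivrMr // mul1r.
Qed.

(* Negative ratios (E_n(f) > ||z^n||) cannot follow a positive one for large n:
   by monotonicity E_(n+1)(f) <= E_n(f) <= ||z^n|| n^(-n/s), whereas
   ln ||z^n|| = O(n). *)
Lemma En_lt_nrm_mono f s : inX X f -> 0 < s ->
  (exists N, forall n, (N <= n)%N -> (ratio_term X f n < s%:E)%E) ->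
  (forall N, exists2 n, (N <= n)%N & (0 < ratio_term X f n)%E) ->
  exists N, forall n, (N <= n)%N -> En X n f < w n.
Proof.
move=> hf s0 [N HN] Hpos.
have [D D1 wD] := nrm_mono_le X.
have [N8 w8] := nrm_mono_ge X.
pose d := ln D; have d0 : 0 <= d by exact: ln_ge0.
have DE : D = expR d by rewrite lnK // posrE; lra.
have l8 : 0 < ln (8 : R) by rewrite ln_gt0 // ltr1n.
(* Needed: n d - n ln n / s < -(n + 1) ln 8. One ln 8 pays for n, the other for the extra index, and
   the 1 makes the inequality strict. *)
have [N1 [N10 HN1]] := ln_nat_large (s * (d + 2 * ln 8 + 1)).
have [n0] := Hpos (maxn (maxn N 2) (maxn N8 N1)).
rewrite !geq_max => /andP[/andP[nN n2] /andP[n8 n1]] n0pos.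
have En0 : En X n0 f < w n0.
  by apply: ratio_term_gt0 => //; rewrite n0pos (lt_trans (HN _ nN)) // ltry.
exists n0; elim=> [|n IH].
  by rewrite leqn0 => /eqP nE; rewrite -nE.
rewrite leq_eqVlt => /predU1P[<-//|]; rewrite ltnS => nn.
have Er := ratio_term_lt hf s0 (IH nn) (HN n (leq_trans nN nn)).
have np : (0 < n)%N by apply: leq_trans nn; exact: ltnW.
have nR : 1 <= (n%:R : R) by rewrite ler1n.
apply: (le_lt_trans (En_decr n hf)); apply: (le_lt_trans Er).
apply: lt_le_trans (w8 n.+1 _); last by rewrite (leq_trans n8) // ltnW.
have H2 : w n <= expR (n%:R * d) by rewrite expRM_natl -DE wD.
apply: (@le_lt_trans _ _ (expR (n%:R * d) * expR (- (nlogn n / s)))).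
  by rewrite ler_wpM2r ?expR_ge0.
have -> : 8 ^+ n.+1 = expR (n.+1%:R * ln 8) :> R by rewrite expRM_natl lnK // posrE.
rewrite -expRN -expRD ltr_expR /nlogn -natr1.
have := HN1 n (leq_trans n1 nn); rewrite mulrC -ler_pdivlMr // => H.
have : n%:R * (d + 2 * ln 8 + 1) <= n%:R * (ln n%:R / s) by rewrite ler_wpM2l.
have : ln 8 <= n%:R * ln 8 :> R by rewrite ler_peMl // ltW.
rewrite -mulrA; lra.
Qed.

End OrderAndApproximation.

Theorem theorem2p2 (R : realType) (X : BanachSpaceD R) (f : R[i] -> R[i])
  (hf : inX X f) (rho : R) (hrho : 0 < rho) :
  (exists F : R[i] -> R[i], entire F /\ (forall z, inD z -> F z = f z) /\
     order_of F = rho%:E)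
  <-> limn_esup (ratio_term X f) = rho%:E.
Proof.
have ratio_lt s : (limn_esup (ratio_term X f) < s%:E)%E ->
    exists N, forall n, (N <= n)%N -> (ratio_term X f n < s%:E)%E.
  by move=> /limf_esup_lt [V [N _ NV] HV]; exists N => n /NV /HV.
have limsup_le s : 0 < s -> (exists N, forall n, (N <= n)%N -> En_rate X s f n) ->
    (limn_esup (ratio_term X f) <= s%:E)%E.
  move=> s0 [N HN].
  apply: (@limf_esup_le R _ _ _ _ _ [set n | (maxn N 2 <= n)%N]).
    by exists (maxn N 2).
  by move=> n /=; rewrite geq_max => /andP[/HN H n2]; exact: ratio_term_le.
split=> [[F [eF [Ff oF]]]|lim].
  have rate s : rho < s -> exists N, forall n, (N <= n)%N -> En_rate X s f n.
    move=> rs; pose s1 := (rho + s) / 2.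
    have s10 : 0 < s1 by rewrite /s1; lra.
    have s1s : s1 < s by rewrite /s1; lra.
    apply: (growth_En_rate hf eF Ff s10 s1s); apply: order_lt_growth => //.
    by rewrite oF lte_fin /s1; lra.
  apply/eqP; rewrite eq_le; apply/andP; split.
    by apply: ereal_le_of_gt => s rs; apply: limsup_le; [lra|exact: rate].
  (* A limsup below rho would make the Taylor series, and so F, of order below rho. The rate at rho
     + 1, already available, supplies E_n(f) < ||z^n||, without which ratios below s carry no
     information. *)
  rewrite leNgt; apply/negP => /(ereal_between hrho) [s [s0 sr /ratio_lt [N HN]]].
  have [|M HM] := rate (rho + 1); first by rewrite ltrDl.
  have r1 : 0 < rho + 1 by lra.
  have [|Hs Hg] := @En_rate_growth R X f s hf s0.
    exists (maxn N (maxn M 2)) => n; rewrite !geq_max => /and3P[Nn Mn n2].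
    apply: ratio_term_lt (HN n Nn) => //.
    exact: En_rate_lt r1 n2 (HM n Mn).
  have FE z : F z = pser (tcoef f) z.
    apply: (entire_eq X eF (pser_entire Hs)) => y yD.
    by rewrite Ff // (pser_eq_inD hf).
  pose s1 := (s + rho) / 2.
  have /Hg gr : s < s1 by rewrite /s1; lra.
  have : (order_of F <= s1%:E)%E.
    by apply: growth_order_le; [rewrite /s1; lra|rewrite (funext FE)].
  by rewrite oF lee_fin /s1; lra.
(* Were the ratios eventually nonpositive, their limsup would not be rho > 0. *)
have pos N : exists2 n, (N <= n)%N & (0 < ratio_term X f n)%E.
  apply: contrapT => H.
  have : (limn_esup (ratio_term X f) <= 0)%E.
    apply: (@limf_esup_le R _ _ _ _ _ [set n | (N <= n)%N]); first by exists N.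
    by move=> n /= Nn; rewrite leNgt; apply/negP => Hn; apply: H; exists n.
  by rewrite lim lee_fin leNgt hrho.
have lt s : rho < s -> exists N, forall n, (N <= n)%N -> (ratio_term X f n < s%:E)%E.
  by move=> rs; apply: ratio_lt; rewrite lim lte_fin.
have [N HN] : exists N, forall n, (N <= n)%N -> En X n f < nrm_mono X n.
  have r1 : 0 < rho + 1 by lra.
  by apply: (En_lt_nrm_mono hf r1) => //; apply: lt; rewrite ltrDl.
have rate s : rho < s -> superexp (tcoef f) /\
    forall s', s < s' -> growth s' (pser (tcoef f)).
  move=> rs; have s0 : 0 < s by lra.
  apply: (En_rate_growth hf s0); have [M HM] := lt s rs.
  exists (maxn N M) => n; rewrite geq_max => /andP[/HN H1 /HM H2].
  exact: ratio_term_lt.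
have [Hs _] : superexp (tcoef f) /\ forall s', rho + 1 < s' -> growth s' (pser (tcoef f)).
  by apply: rate; rewrite ltrDl.
have eF := pser_entire Hs.
have Ff z : inD z -> pser (tcoef f) z = f z by exact: (pser_eq_inD hf).
exists (pser (tcoef f)); split=> //; split=> //.
apply/eqP; rewrite eq_le; apply/andP; split.
  apply: ereal_le_of_gt => s rs; apply: growth_order_le; first lra.
  have [|_ H] := rate ((rho + s) / 2); first lra.
  by apply: H; lra.
(* An order below rho would give a decay rate with some s1 < rho, hence a limsup at most s1. *)
rewrite leNgt; apply/negP => /(ereal_between hrho) [s [s0 sr /(order_lt_growth eF) g]].
pose s1 := (s + rho) / 2.
have s1s : s < s1 by rewrite /s1; lra.
have s10 : 0 < s1 by lra.
have := limsup_le s1 s10 (growth_En_rate hf eF Ff s0 s1s g).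
by rewrite lim lee_fin /s1; lra.
Qed.
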